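(* Let $A$ be a stark connected reduced order with universal grading $(\Gamma,(A_\gamma)_{\gamma\in\Gamma})$ and let $\mu=\mu(A)$. Let $G$ be a finite abelian group. Let $\mathcal{A}=\{\bigoplus_{\gamma\in\Gamma}A_\gamma\, t(\gamma): t\in\operatorname{Hom}(\Gamma,G)\}$, a set of subrings of $A[G]$, and $\mathcal{G}=\{\{s(g)g: g\in G\}: s\in\operatorname{Hom}(G,\mu)\}$, a set of subgroups of $A[G]^*$. Then $$\mathcal{A}\times\mathcal{G}=\{(B,H)\in\mathcal{D}(A[G]): B\text{ is stark}\}.$$
   Context: All rings have a unit element. An order is a commutative ring whose additive group is isomorphic to $\mathbb{Z}^n$ for some $n\geq 0$; it is reduced if it has no non-zero nilpotents, connected if it has exactly two idempotents, and a commutative ring is stark if there do not exist a ring $B$ and a non-trivial group $H$ with it isomorphic to the group ring $B[H]$. $\mu(A)$ is the group of roots of unity of $A$. A grading of a commutative ring $R$ is a pair $(\Delta,(R_\delta)_{\delta\in\Delta})$ with $\Delta$ an abelian group and $R_\delta$ additive subgroups with $R_\gamma R_\delta\subset R_{\gamma\delta}$ and $\bigoplus_\delta R_\delta\to R$ bijective; for a homomorphism $f\colon\Delta\to E$ the pushforward grading is $(E,(\sum_{\delta\in f^{-1}(\epsilon)}R_\delta)_\epsilon)$; a grading $(\Gamma,(R_\gamma))$ is universal if every grading of $R$ is the pushforward of it along a unique homomorphism out of $\Gamma$. Every reduced order has a universal grading (unique up to unique isomorphism) with finite group. For a commutative ring $R$, $\mathcal{D}(R)$ denotes the set of pairs $(B,H)$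 with $B\subset R$ a subring and $H\subset R^*$ a subgroup such that the natural map from the group ring $B[H]$ to $R$ is a ring isomorphism. *)

(* Defs.v *)
From HB Require Import structures.
From mathcomp Require Import all_boot all_order all_algebra.
Set Implicit Arguments. Unset Strict Implicit. Unset Printing Implicit Defensive.
Import GRing.Theory.
Local Open Scope ring_scope.

Definition ahom (D E : zmodType) (f : D -> E) : Prop :=
  forall x y, f (x + y) = f x + f y.

Definition mhom (H : zmodType) (R : comPzRingType) (phi : H -> R) : Prop :=
  phi 0 = 1 /\ forall x y, phi (x + y) = phi x * phi y.

Definition rhom (C R : comPzRingType) (f : C -> R) : Prop :=
  [/\ f 1 = 1, forall x y, f (x + y) = f x + f y & forall x y, f (x * y) = f x * f y].

(** [group_ring_on S f phi]: the subset S of R (with the structure induced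
    from R) is isomorphic to the group ring C[H] via the natural map
    sum c_h h |-> sum f(c_h) phi(h), where f : C -> R is a ring hom and
    phi : H -> R^* a group hom, both landing in S.  Elements of C[H] are
    finitely supported functions H -> C, represented by (uniq hs, c). *)
Definition group_ring_on (R : comPzRingType) (S : R -> Prop)
    (C : comPzRingType) (H : zmodType) (f : C -> R) (phi : H -> R) : Prop :=
  [/\ rhom f, mhom phi,
      (forall c, S (f c)) /\ (forall h, S (phi h)),
      (forall r, S r -> exists (hs : seq H) (c : H -> C),
            uniq hs /\ r = \sum_(h <- hs) f (c h) * phi h) &
      (forall (hs : seq H) (c : H -> C), uniq hs ->
            \sum_(h <- hs) f (c h) * phi h = 0 ->
            forall h, h \in hs -> c h = 0)].

Definition stark_on (R : comPzRingType) (S : R -> Prop) : Prop :=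
  ~ exists (C : comPzRingType) (H : zmodType) (f : C -> R) (phi : H -> R),
      group_ring_on S f phi /\ exists h : H, h != 0.

Definition stark (R : comPzRingType) : Prop := stark_on (fun _ : R => True).

Definition is_order (A : comPzRingType) : Prop :=
  exists (n : nat) (f : A -> 'rV[int]_n), ahom f /\ bijective f.

Definition reduced (A : comPzRingType) : Prop :=
  forall (x : A) (n : nat), x ^+ n = 0 -> x = 0.

Definition connected (A : comPzRingType) : Prop :=
  exists x y : A, x <> y /\ forall e : A, e * e = e <-> (e = x \/ e = y).

Definition mu_elt (A : comPzRingType) (x : A) : Prop :=
  exists n : nat, (0 < n)%N /\ x ^+ n = 1.

Definition grading (A : comPzRingType) (D : zmodType) (Ad : D -> A -> Prop) : Prop :=
  [/\ (forall d, Ad d 0 /\ forall x y, Ad d x -> Ad d y -> Ad d (x - y)),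
      (forall d e x y, Ad d x -> Ad e y -> Ad (d + e) (x * y)),
      (forall r, exists (ds : seq D) (a : D -> A),
          [/\ uniq ds, (forall d, d \in ds -> Ad d (a d)) & r = \sum_(d <- ds) a d]) &
      (forall (ds : seq D) (a : D -> A), uniq ds ->
          (forall d, d \in ds -> Ad d (a d)) -> \sum_(d <- ds) a d = 0 ->
          forall d, d \in ds -> a d = 0)].

Definition pushforward (A : comPzRingType) (D E : zmodType)
    (Ad : D -> A -> Prop) (f : D -> E) (e : E) : A -> Prop :=
  fun r => exists (ds : seq D) (a : D -> A),
    (forall d, d \in ds -> f d = e /\ Ad d (a d)) /\ r = \sum_(d <- ds) a d.

Definition universal_grading (A : comPzRingType) (Gam : zmodType)
    (Ag : Gam -> A -> Prop) : Prop :=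
  grading Ag /\
  forall (E : zmodType) (Ae : E -> A -> Prop), grading Ae ->
    exists f : Gam -> E,
      [/\ ahom f, (forall e r, Ae e r <-> pushforward Ag f e r) &
          forall f' : Gam -> E, ahom f' ->
            (forall e r, Ae e r <-> pushforward Ag f' e r) -> f' =1 f].

Definition subring_of (R : comPzRingType) (B : R -> Prop) : Prop :=
  [/\ B 1, (forall x y, B x -> B y -> B (x - y)) &
      (forall x y, B x -> B y -> B (x * y))].

Definition unit_subgroup (R : comPzRingType) (H : R -> Prop) : Prop :=
  [/\ H 1, (forall x y, H x -> H y -> H (x * y)) &
      (forall x, H x -> exists y, H y /\ x * y = 1)].

Definition in_D (R : comPzRingType) (B H : R -> Prop) : Prop :=
  [/\ subring_of B, unit_subgroup H,
      (forall r, exists (hs : seq R) (b : R -> R),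
          [/\ uniq hs, (forall h, h \in hs -> H h /\ B (b h)) &
              r = \sum_(h <- hs) b h * h]) &
      (forall (hs : seq R) (b : R -> R), uniq hs ->
          (forall h, h \in hs -> H h /\ B (b h)) ->
          \sum_(h <- hs) b h * h = 0 -> forall h, h \in hs -> b h = 0)].

(** The sets in the theorem, inside a model R of A[G] given by
    iota : A -> R and j : G -> R *)
Definition A_t (A R : comPzRingType) (Gam : zmodType) (G : finZmodType)
    (Ag : Gam -> A -> Prop) (iota : A -> R) (j : G -> R) (t : Gam -> G) : R -> Prop :=
  fun r => exists (gs : seq Gam) (a : Gam -> A),
    [/\ uniq gs, (forall g, g \in gs -> Ag g (a g)) &
        r = \sum_(g <- gs) iota (a g) * j (t g)].

Definition H_s (A R : comPzRingType) (G : finZmodType)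
    (iota : A -> R) (j : G -> R) (s : G -> A) : R -> Prop :=
  fun r => exists g : G, r = iota (s g) * j g.

(* Main.v *)
Require Import Defs.
From HB Require Import structures.
From mathcomp Require Import all_boot all_order all_algebra algC algnum separable.
From mathcomp Require Import boolp ring zify.
Set Implicit Arguments. Unset Strict Implicit. Unset Printing Implicit Defensive.
Import Order.TTheory GRing.Theory Num.Theory.
Local Open Scope ring_scope.

(** A reduced order [R] of rank [n] has [n] ring homomorphisms [s k] to the
    algebraic numbers, and [sum_k s k x * conj (s k y)] is a positive definite
    form on [R] for which the components of any grading by a finite group are
    orthogonal. Nonzero elements have norm at least 1, so splitting elements
    orthogonally terminates; hence any two gradings of [R] have a common
    refinement. By AM-GM, an [x] orthogonal to [1 - x] is idempotent, so in a
    connected reduced order every root of unity is homogeneous.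

    If [R = A[G] = B[H]], the degrees of [G] and [H] in the opposite gradings
    give homomorphisms [q : G -> H] and [p : H -> G]. A nonzero kernel of either
    would provide units of [A] or [B] filling a nontrivial group of degrees,
    making that ring a group ring; so starkness forces [p] and [q] to be
    bijective, and [H] is read off from [p], [B] from the common refinement.
    Conversely, twisting [A] by [t] gives an isomorphic subring, and starkness
    makes [g - deg (s g)] injective, which is what is needed for the twisted
    group to be a basis over it. *)

(** * Embeddings of reduced orders *)

(* If [r] were a double root of [m], with minimal polynomial [p], then
   [p ^+ 2 %| m] and [m %/ p] would violate the hypothesis. *)
Lemma sqfree_rat_split (m : {poly rat}) : m != 0 ->
    (forall q, m %| q ^+ 2 -> m %| q) ->
  exists2 rs : seq algC, uniq rs &
    map_poly ratr m %| \prod_(x <- rs) ('X - x%:P).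
Proof.
move=> m0 sqf; set M := map_poly _ m.
have M0 : M != 0 by rewrite map_poly_eq0.
have sepM : separable_poly M.
  rewrite separable_poly.unlock; apply: Pdiv.ClosedField.root_coprimep => x Mx.
  apply/negP => /eqP M'x.
  have [p [_ pmon pP]] := minCpolyP x.
  have p0 : p != 0 by rewrite monic_neq0.
  have px : root (map_poly ratr p) x by rewrite pP.
  have p_gt1 : (1 < size p)%N.
    rewrite ltnNge; apply/negP => /size1_polyC pc; move: px.
    by rewrite pc map_polyC rootC fmorph_eq0 -polyC_eq0 -pc (negPf p0).
  have p'0 : p^`() != 0.
    apply: contraTneq p_gt1 => p'0; rewrite -leqNgt.
    have := congr1 (fun q : {poly rat} => q`_(size p).-2) p'0.
    case Ep: (size p) => [|[|k]] //=; rewrite coef_deriv coef0 => /eqP.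
    rewrite -[k.+1]/(k.+2.-1) -Ep -lead_coefE (eqP pmon) pnatr_eq0.
    by rewrite Ep.
  have pp' : ~~ (p %| p^`()).
    by apply/negP => /(dvdp_leq p'0); rewrite leqNgt lt_size_deriv.
  have /dvdpP[v mE] : p %| m by rewrite -pP.
  (* At [x] the derivative of [m = v * p] reduces to [v * p'], because [p] vanishes there. Since [p]
     does not divide [p'], the value of [p'] is nonzero, so [v] vanishes at [x]. *)
  have /dvdpP[w vE] : p %| v.
    rewrite -pP; move: M'x; rewrite /M deriv_map mE derivM rmorphD !rmorphM /=.
    rewrite hornerD !hornerM (rootP px) mulr0 add0r => /eqP.
    rewrite mulf_eq0 -!rootE !pP => /orP[//|].
    by rewrite (negPf pp').
  have : m %| w * p.
    apply: sqf; have -> : (w * p) ^+ 2 = w * m.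
      by rewrite expr2 mE vE -!mulrA [p * (w * p)]mulrCA.
    exact: dvdp_mulIr.
  have wp0 : w * p != 0 by apply: contraNneq m0 => wp; rewrite mE vE wp mul0r.
  move/(dvdp_leq wp0); rewrite mE vE size_mul //; move: p_gt1.
  by case: (size p) => [|[|k]] // _; rewrite !addnS ltnNge leq_addr.
have [rs ME] := closed_field_poly_normal M.
exists rs; last by rewrite ME dvdpZl ?lead_coef_eq0.
rewrite -separable_prod_XsubC -(eqp_separable (p := M)) //.
by rewrite ME eqp_scale ?lead_coef_eq0.
Qed.

Section RegularRepresentation.
Variables (R : comPzRingType) (n : nat).
Variables (f : {additive R -> 'rV[int]_n}) (fi : {additive 'rV[int]_n -> R}).
Hypotheses (fK : cancel f fi) (fiK : cancel fi f).

(** The matrix of [u] in the basis transported by [f]. It acts on rows from the right, so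
    composition reverses factors; for multiplications this is absorbed by commutativity. *)
Definition regmx (u : R -> R) : 'M[int]_n := \matrix_i f (u (fi (delta_mx 0 i))).

Lemma mul_regmx (u : {additive R -> R}) v : v *m regmx u = f (u (fi v)).
Proof.
rewrite mulmx_sum_row [v in RHS]row_sum_delta !raddf_sum.
apply: eq_bigr => i _; rewrite rowK -[in RHS](intz (v 0 i)) scaler_int !raddfMz.
by rewrite -scaler_int intz.
Qed.

Lemma regmx_comp (u w : {additive R -> R}) (uw : {additive R -> R}) :
  (forall x, uw x = u (w x)) -> regmx uw = regmx w *m regmx u.
Proof.
move=> E; apply/row_matrixP => i.
by rewrite row_mul rowK mul_regmx rowK fK E.
Qed.

Definition mulr_fun (x y : R) := x * y.
HB.instance Definition _ x :=
  GRing.isZmodMorphism.Build R R (mulr_fun x) (mulrBr x).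

Definition rmx x := regmx (mulr_fun x).

Lemma rmxM x y : rmx (x * y) = rmx x *m rmx y.
Proof.
apply: regmx_comp => z; rewrite /= /mulr_fun mulrA; congr (_ * _).
exact: mulrC.
Qed.

Lemma rmx_is_zmod_morphism : zmod_morphism rmx.
Proof.
move=> x y; apply/matrixP => i k.
by rewrite !mxE /mulr_fun mulrBl raddfB !mxE.
Qed.
HB.instance Definition _ := GRing.isZmodMorphism.Build R 'M[int]_n rmx
  rmx_is_zmod_morphism.

Lemma rmx1 : rmx 1 = 1%:M.
Proof.
apply/row_matrixP => i; rewrite rowK /mulr_fun mul1r fiK row1 //.
Qed.

Lemma rmx_inj x : rmx x = 0 -> x = 0.
Proof.
move=> x0; apply: (can_inj fK); rewrite raddf0 -[x]mulr1 -(fK 1) -(mul_regmx (mulr_fun x)).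
by rewrite -/(rmx x) x0 mulmx0.
Qed.

Lemma rmx_comm x y : comm_mx (rmx x) (rmx y).
Proof. by rewrite /comm_mx -!rmxM mulrC. Qed.

Lemma rmx_basis x : rmx x = \sum_i f x 0 i *: rmx (fi (delta_mx 0 i)).
Proof.
rewrite -[x in LHS]fK [f x in LHS]row_sum_delta !raddf_sum; apply: eq_bigr => i _.
by rewrite -[in LHS](intz (f x 0 i)) scaler_int !raddfMz -scaler_int intz.
Qed.

End RegularRepresentation.

(* A grading by a finite group, given by its family of projections. *)
Definition pgrading (R : comPzRingType) (D : finZmodType)
    (P : D -> {additive R -> R}) : Prop :=
  [/\ forall x, \sum_d P d x = x,
      forall d e x, P d (P e x) = if d == e then P e x else 0 &
      forall d e x y, P d x = x -> P e y = y -> P (d + e) (x * y) = x * y].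

Section PGradingTheory.
Variables (R : comPzRingType) (D : finZmodType) (P : D -> {additive R -> R}).
Hypothesis gP : pgrading P.

Lemma pgr_sum x : \sum_d P d x = x. Proof. by case: gP. Qed.
Lemma pgr_proj d e x : P d (P e x) = if d == e then P e x else 0.
Proof. by case: gP. Qed.
Lemma pgr_id d x : P d (P d x) = P d x. Proof. by rewrite pgr_proj eqxx. Qed.
Lemma pgr_mul d e x y : P d x = x -> P e y = y -> P (d + e) (x * y) = x * y.
Proof. by case: gP => _ _; apply. Qed.
Lemma pgr_neq d e x : P e x = x -> d != e -> P d x = 0.
Proof. by move=> <- de; rewrite pgr_proj (negPf de). Qed.
Lemma pgr_uniq d e x : x != 0 -> P d x = x -> P e x = x -> d = e.
Proof.
move=> x0 dx ex; apply/eqP; apply: contraNT x0 => de.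
by rewrite -dx (pgr_neq ex de).
Qed.
Lemma pgr_mulr d e x y : P e y = y -> P (d + e) (x * y) = P d x * y.
Proof.
move=> ey; rewrite -{1}(pgr_sum x) mulr_suml raddf_sum (bigD1 d) //=.
rewrite pgr_mul ?pgr_id // big1 ?addr0 // => c cd.
have cxy : P (c + e) (P c x * y) = P c x * y by rewrite pgr_mul ?pgr_id.
by rewrite (pgr_neq cxy) // (inj_eq (addIr e)) eq_sym.
Qed.
(** By [pgr_mulr], the degree 0 part of 1 fixes every homogeneous element, hence all of [R]. *)
Lemma pgr_one : P 0 1 = 1.
Proof.
have H y : P 0 1 * y = y.
  rewrite -[y](pgr_sum) mulr_sumr; apply: eq_bigr => e _.
  by rewrite -(pgr_mulr 0 1 (pgr_id e y)) add0r mul1r pgr_id.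
by rewrite -[LHS]mulr1 H.
Qed.
Lemma pgr_exp d x m : P d x = x -> P (d *+ m) (x ^+ m) = x ^+ m.
Proof.
move=> dx; elim: m => [|m IH]; first by rewrite mulr0n expr0 pgr_one.
by rewrite mulrS exprS pgr_mul.
Qed.
End PGradingTheory.

Section Trace.
Variables (R : comPzRingType) (n : nat).
Variables (f : {additive R -> 'rV[int]_n}) (fi : {additive 'rV[int]_n -> R}).
Hypotheses (fK : cancel f fi) (fiK : cancel fi f).

(** Multiplication by [x] carries degree [g] into degree [d + g], which differs from [g], so no
    diagonal block contributes. With [E] the idempotent matrix of [P g], the contribution of [g] is
    the trace of [E *m X *m E], which is zero. *)
Lemma mxtrace_rmx_homogeneous (D : finZmodType) (P : D -> {additive R -> R}) d x :
  pgrading P -> d != 0 -> P d x = x -> \tr (rmx f fi x) = 0.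
Proof.
move=> gP d0 dx; set X := rmx f fi x.
have -> : X = \sum_g X *m regmx f fi (P g).
  apply/row_matrixP => i; rewrite -mulmx_sumr row_mul rowK.
  have -> : \sum_g regmx f fi (P g) = 1%:M.
    apply/row_matrixP => k; rewrite raddf_sum row1 /=.
    under eq_bigr do rewrite rowK.
    by rewrite -raddf_sum pgr_sum // fiK.
  by rewrite mulmx1.
rewrite raddf_sum big1 // => g _ /=; set E := regmx f fi (P g).
have EE : E = E *m E.
  by apply: (regmx_comp fK (u := P g) (w := P g)) => y; rewrite pgr_id.
rewrite EE mulmxA mxtrace_mulC mulmxA.
suff -> : E *m X *m E = 0 by rewrite mxtrace0.
apply/row_matrixP => i; rewrite !row_mul row0 rowK.
rewrite (mul_regmx f fi (mulr_fun x)) mul_regmx // !fK /mulr_fun.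
set y := P g (fi _); have yg : P g y = y by rewrite /y pgr_id.
have xy : P (d + g) (x * y) = x * y by apply: pgr_mul.
by rewrite (pgr_neq gP xy) ?raddf0 // -subr_eq0 opprD addrCA subrr addr0 oppr_eq0.
Qed.

End Trace.

Lemma map_mx_intr_eq0 (F : numDomainType) m n (A : 'M[int]_(m, n)) :
  map_mx (intr : int -> F) A = 0 -> A = 0.
Proof.
move=> A0; apply/matrixP => i k; have /matrixP/(_ i k) := A0.
by rewrite !mxE => /eqP; rewrite intr_eq0 => /eqP.
Qed.

(** Up to a denominator, [q] evaluated at the matrix of [x] is the matrix of some [y] in [R]. If [m]
    divides [q ^+ 2] then [y ^+ 2 = 0], so [y = 0] and [q] kills the matrix. *)
Lemma mxminpoly_rmx_sqfree (R : comPzRingType) (n' : nat) (n := n'.+1)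
    (f : {additive R -> 'rV[int]_n}) (fi : {additive 'rV[int]_n -> R})
    (fK : cancel f fi) (fiK : cancel fi f) (redR : reduced R) (x : R)
    (m := mxminpoly (map_mx intr (rmx f fi x) : 'M[rat]_n)) (q : {poly rat}) :
  m %| q ^+ 2 -> m %| q.
Proof.
set M := map_mx _ _ in m *.
have lift (p : {poly int}) : exists y : R,
    map_mx intr (rmx f fi y) = horner_mx M (map_poly intr p).
  elim/poly_ind: p => [|p c [y IH]].
    by exists 0; rewrite raddf0 map_mx0 !rmorph0.
  exists (y * x + 1 *~ c); rewrite raddfD raddfMz /= rmxM // rmx1 //.
  rewrite map_mxD map_mxM IH rmorphD rmorphM /= map_polyX map_polyC /=.
  rewrite rmorphD rmorphM /= horner_mx_X horner_mx_C; congr (_ + _).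
  by rewrite -scaler_int map_mxZ map_mx1 scalemx1 intz.
have [p [a a0 ->]] := rat_poly_scale q; have [y yE] := lift p.
have ar0 : a%:~R^-1 != 0 :> rat by rewrite invr_eq0 intr_eq0.
rewrite exprZn !dvdpZr ?expf_neq0 // => /dvdpP[v vE].
have y20 : y ^+ 2 = 0.
  apply: (rmx_inj fK); rewrite expr2 rmxM //.
  apply: (@map_mx_intr_eq0 rat); rewrite map_mxM /= yE -[_ *m _]/(_ * _) -rmorphM /= -expr2 vE.
  by rewrite rmorphM /= mx_root_minpoly mulr0.
apply: mxminpoly_min; rewrite -yE (redR _ _ y20) raddf0.
by apply/matrixP => i k; rewrite !mxE.
Qed.

(* The last clause says that homogeneous elements of nonzero degree have trace
   zero; the trace of [x] is [\sum_k s k x]. *)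
Definition embeddings (R : comPzRingType) (n : nat)
    (s : 'I_n -> {rmorphism R -> algC}) : Prop :=
  [/\ forall x, (forall k, s k x = 0) -> x = 0,
      forall x, exists p : {poly int},
        map_poly intr p = \prod_k ('X - (s k x)%:P) &
      forall (D : finZmodType) (P : D -> {additive R -> R}) d x,
        pgrading P -> d != 0 -> P d x = x -> \sum_k s k x = 0].

Lemma order_additive_bij (R : comPzRingType) : is_order R ->
  exists (n : nat) (f : {additive R -> 'rV[int]_n}) (fi : {additive 'rV[int]_n -> R}),
    cancel f fi /\ cancel fi f.
Proof.
move=> [n [f [fD [fi fK fiK]]]]; exists n.
have f0 : f 0 = 0 by apply: (addIr (f 0)); rewrite -fD !add0r.
have fB : zmod_morphism f.
  move=> x y; apply: (addIr (f y)); rewrite -fD !subrK //.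
have fiB : zmod_morphism fi by move=> x y; apply: (can_inj fK); rewrite fB !fiK.
pose F : {additive _ -> _} := HB.pack f (GRing.isZmodMorphism.Build _ _ f fB).
pose Fi : {additive _ -> _} := HB.pack fi (GRing.isZmodMorphism.Build _ _ fi fiB).
by exists F, Fi.
Qed.

Lemma char_poly_conj (F : fieldType) n (Q A : 'M[F]_n) : Q \in unitmx ->
  char_poly (Q *m A *m invmx Q) = char_poly A.
Proof.
move=> Qu.
have QV : map_mx polyC Q *m map_mx polyC (invmx Q) = 1%:M.
  by rewrite -map_mxM mulmxV // map_mx1.
have E : char_poly_mx (Q *m A *m invmx Q) =
    map_mx polyC Q *m char_poly_mx A *m map_mx polyC (invmx Q).
  rewrite /char_poly_mx mulmxBr mulmxBl scalar_mxC -(mulmxA 'X%:M) QV mulmx1.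
  by rewrite !map_mxM.
by rewrite /char_poly E !det_mulmx mulrAC -det_mulmx QV det1 mul1r.
Qed.

(** Multiplication matrices commute and have separable minimal polynomials, so they are
    simultaneously diagonalizable over [algC]. Each diagonal position then gives a ring
    homomorphism. *)
Lemma reduced_order_embeddings (R : comPzRingType) : is_order R -> reduced R ->
  exists n (s : 'I_n -> {rmorphism R -> algC}), embeddings s.
Proof.
move=> /order_additive_bij[[|n'] [f [fi [fK fiK]]]] redR.
  (* Rank 0 is treated apart because minimal polynomials are taken for matrices of positive size. *)
  have s0 : 'I_0 -> {rmorphism R -> algC} by case.
  exists 0%N, s0; split=> [x _|x|D P d x _ _ _]; last by rewrite big_ord0.
    by apply: (can_inj fK); apply/rowP => -[].
  by exists 1; rewrite big_ord0 rmorph1.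
set n := n'.+1 in f fi fK fiK *.
pose M x : 'M[algC]_n := map_mx intr (rmx f fi x).
have diagM x : diagonalizable (M x).
  apply/diagonalizableP;
  have := sqfree_rat_split _ (mxminpoly_rmx_sqfree fK fiK redR (x := x)).
  rewrite monic_neq0 ?mxminpoly_monic // => /(_ isT)[rs urs]; rewrite -mxminpoly_map.
  by rewrite -map_mx_comp (eq_map_mx _ (ratr_int _)) => dv; exists rs.
pose As := [seq M (fi (delta_mx 0 i)) | i : 'I_n].
have [Q Qu /allP QA] : codiagonalizable As.
  apply/codiagonalizableP; split=> [A B|A].
    by move=> /mapP[i _ ->] /mapP[k _ ->]; rewrite /comm_mx -!map_mxM rmx_comm.
  by move=> /mapP[i _ ->].
pose c x := Q *m M x *m invmx Q.
have MD x y : M (x - y) = M x - M y by rewrite /M raddfB map_mxB.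
have MM x y : M (x * y) = M x *m M y by rewrite /M rmxM // map_mxM.
have cB x y : c (x - y) = c x - c y by rewrite /c MD mulmxBr mulmxBl.
have cM x y : c (x * y) = c x *m c y by rewrite /c MM !mulmxA mulmxKV.
have cdiag x : is_diag_mx (c x).
  (* Only the matrices of the basis elements were diagonalized together; a general [x] is an integer
     combination of them. *)
  have -> : c x = \sum_i (f x 0 i)%:~R *: c (fi (delta_mx 0 i)).
    rewrite /c {1}/M (rmx_basis fK) raddf_sum mulmx_sumr mulmx_suml.
    apply: eq_bigr => i _ /=; rewrite map_mxZ -scalemxAr -scalemxAl //.
  apply: (big_ind (fun A : 'M[algC]_n => is_diag_mx A)).
  - exact: mx0_is_diag.
  - move=> A B /is_diag_mxP dA /is_diag_mxP dB; apply/is_diag_mxP => i k ik.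
    by rewrite mxE dA ?dB ?addr0.
  move=> i _; have /QA : M (fi (delta_mx 0 i)) \in As by apply: map_f; rewrite mem_enum.
  move=> /= /diagonalizable_forPex[d /(simmxRL Qu) dE]; rewrite /c -dE.
  by apply/is_diag_mxP => k l kl; rewrite !mxE -val_eqE (negPf kl) mulr0.
pose s k x := c x k k.
have sB k : zmod_morphism (s k) by move=> x y; rewrite /s cB !mxE.
have sM k : monoid_morphism (s k).
  split=> [|x y]; rewrite /s.
    by rewrite /c /M rmx1 // map_mx1 mulmx1 mulmxV // mxE eqxx.
  rewrite cM mxE (bigD1 k) //= big1 ?addr0 // => i ik.
  by have /is_diag_mxP -> := cdiag x; rewrite ?mul0r // eq_sym.
pose S k : {rmorphism R -> algC} := HB.pack (s k)
  (GRing.isZmodMorphism.Build _ _ (s k) (sB k))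
  (GRing.isMonoidMorphism.Build _ _ (s k) (sM k)).
have Mc x : M x = invmx Q *m c x *m Q by rewrite /c !mulmxA mulVmx // mul1mx mulmxKV.
have cE x : c x = diag_mx (\row_k s k x).
  apply/matrixP => i k; rewrite [RHS]mxE [in RHS]mxE; case: (eqVneq i k) => [->|ik] //=.
  by have /is_diag_mxP -> := cdiag x.
exists n, S; split=> [x x0|x|D P d x gP d0 dx].
- apply: (rmx_inj fK); apply: (@map_mx_intr_eq0 algC).
  rewrite -[LHS]/(M x) Mc cE.
  have -> : \row_k s k x = 0 by apply/rowP => k; rewrite !mxE; apply: x0.
  by rewrite raddf0 mulmx0 mul0mx.
- exists (char_poly (rmx f fi x)); rewrite map_char_poly -[map_mx _ _]/(M x).
  rewrite -(char_poly_conj _ Qu) -/(c x) char_poly_trig ?is_diag_mx_is_trig //.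
- have tr0 : \tr (M x) = 0.
    by rewrite trace_map_mx (mxtrace_rmx_homogeneous _ _ gP d0 dx).
  by rewrite -[RHS]tr0 Mc -mulmxA mxtrace_mulC mulmxKV ?cE ?mxtrace_diag //;
    apply: eq_bigr => k _; rewrite mxE.
Qed.

(** * The positive definite form *)

(** Translation by [h] permutes [D], so adding [h] to every term leaves the sum of all elements
    unchanged. *)
Lemma mulrn_card (D : finZmodType) (h : D) : h *+ #|D| = 0.
Proof.
apply: (addrI (\sum_(d : D) d)); rewrite addr0.
rewrite [in RHS](reindex_inj (addIr h)) big_split /=; congr (_ + _).
by rewrite sumr_const.
Qed.

Lemma lagrange_interpolation (F : fieldType) (v : F -> F) (s : seq F) :
  exists q : {poly F}, forall z, z \in s -> q.[z] = v z.
Proof.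
elim: s => [|a s [q qv]]; first by exists 0.
case: (boolP (a \in s)) => [sa|nsa].
  by exists q => z; rewrite inE => /predU1P[->|]; apply: qv.
pose w : {poly F} := \prod_(b <- s) ('X - b%:P).
have w0 : w.[a] != 0 by rewrite -rootE root_prod_XsubC.
exists (q + ((v a - q.[a]) / w.[a]) *: w) => z; rewrite inE !hornerE.
case/predU1P => [->|sz]; first by rewrite divfK // addrC subrK.
have /rootP -> : root w z by rewrite root_prod_XsubC.
by rewrite mulr0 addr0 qv.
Qed.

Section InnerProduct.
Variables (R : comPzRingType) (n : nat) (s : 'I_n -> {rmorphism R -> algC}).
Hypothesis embS : embeddings s.

Definition ip x y : algC := \sum_k s k x * (s k y)^*.

Lemma emb_inj x y : (forall k, s k x = s k y) -> x = y.
Proof.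
move=> xy; apply/eqP; rewrite -subr_eq0; apply/eqP; case: embS => inj _ _.
by apply: inj => k; rewrite rmorphB xy subrr.
Qed.

Lemma ipDl x y z : ip (x + y) z = ip x z + ip y z.
Proof. by rewrite -big_split; apply: eq_bigr => k _; rewrite rmorphD mulrDl. Qed.
Lemma ipBr x y z : ip x (y - z) = ip x y - ip x z.
Proof. by rewrite -sumrB; apply: eq_bigr => k _; rewrite !rmorphB mulrBr. Qed.
Lemma ip0r x : ip x 0 = 0.
Proof. by rewrite /ip big1 // => k _; rewrite !rmorph0 mulr0. Qed.
Lemma ip_conj x y : (ip x y)^* = ip y x.
Proof.
by rewrite rmorph_sum; apply: eq_bigr => k _; rewrite rmorphM /= conjCK mulrC.
Qed.
Lemma ipxx x : ip x x = \sum_k `|s k x| ^+ 2.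
Proof. by apply: eq_bigr => k _; rewrite normCK. Qed.
Lemma ip_ge0 x : 0 <= ip x x.
Proof. by rewrite ipxx sumr_ge0 // => k _; rewrite exprn_ge0. Qed.
Lemma ip_eq0 x : ip x x = 0 -> x = 0.
Proof.
move=> /eqP; rewrite ipxx psumr_eq0 => [/allP x0|k _]; last by rewrite exprn_ge0.
apply: emb_inj => k; rewrite rmorph0.
by have := x0 k (mem_index_enum k); rewrite expf_eq0 /= normr_eq0 => /eqP.
Qed.
Lemma ip_sumr (I : finType) (F : I -> R) x : ip x (\sum_i F i) = \sum_i ip x (F i).
Proof.
rewrite exchange_big; apply: eq_bigr => k _ /=.
by rewrite !rmorph_sum mulr_sumr.
Qed.

Lemma charpoly_intr x i :
  (\prod_k ('X - (s k x)%:P) : {poly algC})`_i \in Num.int.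
Proof.
by case: embS => _ /(_ x)[p <-] _; rewrite coef_map intr_int.
Qed.

(* The lowest nonzero coefficient of the characteristic polynomial is, up to
   sign, the product of the nonzero conjugates of [x], and it is an integer. *)
Lemma emb_small x : (forall k, `|s k x| < 1) -> x = 0.
Proof.
move=> small; case: embS => inj _ _; apply: inj => k; apply/eqP.
apply: contraT => xk; pose B := [pred k | s k x != 0].
pose q : {poly algC} := \prod_(k in B) ('X - (s k x)%:P).
pose m := #|[predC B]|.
have E : \prod_k ('X - (s k x)%:P) = q * 'X^m.
  rewrite (bigID B) /=; congr (_ * _); rewrite /m -prodr_const.
  by apply: eq_bigr => i; rewrite negbK => /eqP->; rewrite subr0.
have : q`_0 \in Num.int.
  by have := charpoly_intr x m; rewrite E coefMXn ltnn subnn.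
have normq : `|q`_0| = \prod_(k in B) `|s k x|.
  rewrite -horner_coef0 horner_prod normr_prod; apply: eq_bigr => i _.
  by rewrite !hornerE normrN.
have q0 : q`_0 != 0.
  by rewrite -normr_eq0 normq prodf_seq_neq0; apply/allP => i _;
    rewrite normr_eq0; apply/implyP.
move=> /norm_intr_ge1 -/(_ q0); rewrite normq (bigD1 k) //= => ge1.
have le1 : \prod_(i in B | i != k) `|s i x| <= 1.
  by apply: prodr_ile1 => i _; rewrite normr_ge0 ltW.
have : `|s k x| * \prod_(i in B | i != k) `|s i x| < 1.
  by apply: le_lt_trans (small k); rewrite ler_piMr.
by rewrite (le_gtF ge1).
Qed.

Lemma ip_ge1 x : x != 0 -> 1 <= ip x x.
Proof.
move=> x0; have rx : ip x x \is Num.real by rewrite ger0_real // ip_ge0.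
rewrite real_leNgt ?real1 //; apply: contra x0 => lt1; apply/eqP/emb_small => k.
rewrite -(expr_lt1 (_ : 0 < 2)%N) //; apply: le_lt_trans lt1.
by rewrite ipxx (bigD1 k) //= lerDl sumr_ge0 // => i _; rewrite exprn_ge0.
Qed.

(** The product is the absolute value of the constant term of an integral characteristic polynomial.
    It is nonzero, since a vanishing factor would give [s k y = 1/2], which is not an algebraic
    integer. *)
Lemma norm_emb_odd_ge1 y : 1 <= \prod_k `|s k (1 - y *+ 2)|.
Proof.
set w := 1 - _; pose q : {poly algC} := \prod_k ('X - (s k w)%:P).
have normq : `|q`_0| = \prod_k `|s k w|.
  rewrite -horner_coef0 horner_prod normr_prod; apply: eq_bigr => i _.
  by rewrite !hornerE normrN.
rewrite -normq norm_intr_ge1 ?charpoly_intr // -normr_eq0 normq.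
apply/prodf_neq0 => k _; rewrite normr_eq0; apply/negP => wk.
have sy : s k y = 2^-1.
  move: wk; rewrite rmorphB rmorph1 rmorphMn subr_eq0 -mulr_natr => /eqP e.
  by apply: (@mulIf _ 2); rewrite ?mulVf ?pnatr_eq0 // -e.
have : 2^-1 \in Aint.
  rewrite -sy; apply: (@root_monic_Aint (\prod_k ('X - (s k y)%:P))).
  - rewrite -(big_map (fun k => s k y) predT (fun z => 'X - z%:P)) root_prod_XsubC.
    by apply/mapP; exists k; rewrite ?mem_index_enum.
  - by rewrite monic_prod // => i _; rewrite monicXsubC.
  by apply/polyOverP => i; apply: charpoly_intr.
move/Cint_rat_Aint => /(_ _)/norm_intr_ge1.
rewrite invr_neq0 ?pnatr_eq0 // ger0_norm ?invr_ge0 ?ler0n //.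
rewrite invf_ge1 ?ltr0n // (ler_nat _ 2 1) => H; suff: false by [].
by apply: H => //; rewrite rpredV rpred_nat.
Qed.

(* With [w = 1 - 2y] the hypothesis reads [ip w w <= n], while the norm of [w]
   is an odd integer; by AM-GM all [|s k w|] are 1, so that [|s k (y(1-y))|] is
   at most 1/2 for all k. *)
Lemma ip_idempotent y : 0 <= ip y (1 - y) -> y * y = y.
Proof.
move=> ge0; pose w := 1 - y *+ 2; pose E k := `|s k w| ^+ 2.
have EE k : E k = 1 - (s k y * (s k (1 - y))^*) *+ 2 - ((s k (1 - y)) * (s k y)^*) *+ 2.
  rewrite /E normCK /w !rmorphB !rmorph1 !rmorphMn /=; ring.
have ipC : ip (1 - y) y = ip y (1 - y) by rewrite -ip_conj geC0_conj.
have sumE : \sum_k E k <= n%:R.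
  rewrite (eq_bigr _ (fun k _ => EE k)) !sumrB sumr_const card_ord.
  rewrite !sumrMnl -/(ip _ _) -[X in _ - X *+ 2]/(ip (1 - y) y) ipC.
  by rewrite -addrA gerDl -opprD oppr_le0 addr_ge0 // mulrn_wge0.
have E_ge0 k : 0 <= E k by rewrite exprn_ge0.
have E_le1 k : E k <= 1.
  have n_gt0 : (0 < n)%N by case: (n) k => [[]|].
  have := leif_AGM (A := 'I_n) (fun i _ => E_ge0 i); rewrite card_ord.
  set mu := _ / _ => -[AGM Eq].
  have mu_ge0 : 0 <= mu by rewrite divr_ge0 ?sumr_ge0 ?ler0n.
  have mu_le1 : mu <= 1 by rewrite ler_pdivrMr ?ltr0n // mul1r.
  have prod_ge1 : 1 <= \prod_(i in 'I_n) E i.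
    by rewrite prodrXl exprn_ege1 // norm_emb_odd_ge1.
  have : \prod_(i in 'I_n) E i == mu ^+ n.
    by rewrite eq_le AGM (le_trans _ prod_ge1) ?exprn_ile1.
  rewrite Eq => /forall_inP/(_ k isT)/forall_inP eqE.
  have -> : E k = mu; last by [].
  rewrite /mu (eq_bigr (fun=> E k)) => [|i _]; last by rewrite (eqP (eqE i isT)).
  by rewrite sumr_const card_ord -(mulr_natr (E k)) mulfK // pnatr_eq0 -lt0n.
apply/eqP; rewrite -subr_eq0 -oppr_eq0 opprB; apply/eqP/emb_small => k.
have -> : y - y * y = y * (1 - y) by rewrite mulrBr mulr1.
rewrite rmorphM normrM; set a := `|_|; set b := `|_|.
(* Parallelogram law for [s k y] and [s k (1 - y)], whose sum is 1 and whose difference is, up to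
   sign, [s k w]. *)
have ab : a ^+ 2 + b ^+ 2 <= 1.
  have : (a ^+ 2 + b ^+ 2) *+ 2 = 1 + E k.
    rewrite /a /b /E !normCK /w !rmorphB !rmorph1 !rmorphMn /=; ring.
  move=> e; rewrite -(ler_pMn2r (_ : 0 < 2)%N) // e mulr2n lerD2l; exact: E_le1.
have : a * b *+ 2 <= 1.
  apply: le_trans ab; rewrite -subr_ge0 addrAC -sqrrB real_exprn_even_ge0 //.
  by rewrite rpredB // normr_real.
rewrite -mulr_natr -ler_pdivlMr ?ltr0n // mul1r => /le_lt_trans; apply.
by rewrite invf_lt1 ?ltr0n // (ltr_nat _ 1 2).
Qed.

(* For [y] homogeneous of degree [h] and [m *: h = 0], interpolation gives a
   polynomial [q] with [conj (s k y) = s k (y ^+ m.-1) * q.[s k (y ^+ m)]]; so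
   [conj y] behaves like an element of degree [- h]. *)
Lemma homogeneous_orthogonal (D : finZmodType) (P : D -> {additive R -> R}) g h x y :
  pgrading P -> P g x = x -> P h y = y -> g != h -> ip x y = 0.
Proof.
move=> gP gx hy gh; pose m := #|D|.
have m_gt0 : (0 < m)%N by apply/card_gt0P; exists 0.
have mh : h *+ m = 0.
  exact: mulrn_card.
(* At [z = s k y ^+ m] the squared root of the norm is the product of [s k y] and its conjugate, so
   [v z * s k y ^+ m.-1] is that conjugate. When [s k y = 0] the numerator vanishes, so the division
   by zero does no harm. *)
pose v (z : algC) : algC := (m.-root `|z|) ^+ 2 / z.
have [q qv] := lagrange_interpolation v [seq s k (y ^+ m) | k : 'I_n].
have conjE k : (s k y)^* = s k y ^+ m.-1 * q.[s k (y ^+ m)].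
  rewrite qv; last by apply/mapP; exists k; rewrite ?mem_enum.
  rewrite /v rmorphXn normrX exprCK //.
  have [->|z0] := eqVneq (s k y) 0.
    by rewrite conjC0 normr0 [0 ^+ 2]expr0n /= mul0r mulr0.
  have w0 := expf_neq0 m.-1 z0; rewrite normCK -[X in _ / _ ^+ X](prednK m_gt0) exprS.
  by rewrite -mulf_div mulfV // mul1r mulrC divfK.
have -> : ip x y = \sum_(i < size q) q`_i * \sum_k s k (x * y ^+ (m.-1 + m * i)).
  under [RHS]eq_bigr do rewrite mulr_sumr.
  rewrite exchange_big; apply: eq_bigr => k _ /=.
  rewrite conjE horner_coef !mulr_sumr; apply: eq_bigr => i _.
  by rewrite rmorphM !rmorphXn exprD exprM; ring.
apply: big1 => i _; case: embS => _ _ trace0.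
(* As [h *+ m = 0], the degree of each term is [g - h], which is nonzero; its trace therefore
   vanishes. *)
rewrite (trace0 D P (g + h *+ (m.-1 + m * i))) ?mulr0 //.
  apply: contra gh => /eqP e; apply/eqP/(addIr (h *+ m.-1)); rewrite -mulrS prednK // mh.
  by move: e; rewrite mulrnDr mulrnA mh mul0rn addr0.
by rewrite pgr_mul ?pgr_exp.
Qed.

End InnerProduct.

(** * Orthogonal projections and common refinements *)

Section GradedInnerProduct.
Variables (R : comPzRingType) (n : nat) (s : 'I_n -> {rmorphism R -> algC}).
Hypothesis embS : embeddings s.
Variables (D : finZmodType) (P : D -> {additive R -> R}).
Hypothesis gP : pgrading P.

Lemma ip_projl d x y : ip s (P d x) y = ip s (P d x) (P d y).
Proof.
rewrite -{1}(pgr_sum gP y) ip_sumr (bigD1 d) //= big1 ?addr0 // => e ed.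
by apply: (homogeneous_orthogonal embS gP (pgr_id gP d x) (pgr_id gP e y)); rewrite eq_sym.
Qed.

Lemma ip_proj_orth d x : ip s (P d x) (x - P d x) = 0.
Proof. by rewrite ipBr ip_projl subrr. Qed.

Lemma ip_proj_split d x :
  ip s x x = ip s (P d x) (P d x) + ip s (x - P d x) (x - P d x).
Proof.
have h := ip_proj_orth d x; set a := P d x in h *; set b := x - a in h *.
have xab : x = a + b by rewrite addrC subrK.
have ipDr y z t : ip s t (y + z) = ip s t y + ip s t z.
  by rewrite -(ip_conj s (y + z)) ipDl rmorphD /= !ip_conj.
move: xab h; move: a b => a b -> h.
by rewrite ipDl !ipDr h -(ip_conj s a b) h conjC0 addr0 add0r.
Qed.
End GradedInnerProduct.

(* Splitting [x] into two nonzero orthogonal summands lowers [ip x x] by at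
   least 1, so by induction [x] is a sum of elements homogeneous for both
   gradings. *)
Lemma pgradings_commute (R : comPzRingType) (D E : finZmodType)
    (P : D -> {additive R -> R}) (Q : E -> {additive R -> R}) :
    is_order R -> reduced R -> pgrading P -> pgrading Q ->
  forall d e x, P d (Q e x) = Q e (P d x).
Proof.
move=> oR rR gP gQ d e x.
have [n [s embS]] := reduced_order_embeddings oR rR.
have := archi_boundP (ip_ge0 s x); move: (Num.bound _) => k.
elim: k x => [|k IH] x; first by move=> /(le_lt_trans (ip_ge0 s x)); rewrite ltxx.
move=> ltk.
(* A proper orthogonal summand [y] and its complement both have form at least 1, hence both fall
   under the induction hypothesis. If neither grading splits [x], each projection sends [x] to 0 or
   [x] and they commute on it. *)
have split_at y : ip s x x = ip s y y + ip s (x - y) (x - y) ->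
    y != 0 -> y != x -> P d (Q e x) = Q e (P d x).
  move=> xE y0 yx; have z0 : x - y != 0 by rewrite subr_eq0 eq_sym.
  have ly : ip s y y < k%:R.
    rewrite -(ltrD2r 1) natr1; apply: le_lt_trans ltk.
    by rewrite xE lerD2l (ip_ge1 embS).
  have lz : ip s (x - y) (x - y) < k%:R.
    rewrite -(ltrD2l 1) nat1r; apply: le_lt_trans ltk.
    by rewrite xE lerD2r (ip_ge1 embS).
  move: lz; rewrite -{3 4}(subrK y x); move: (x - y) => z lz.
  by rewrite !raddfD /= !IH.
have [Px0|Px0] := eqVneq (P d x) 0; last first.
  have [Pxx|Pxx] := eqVneq (P d x) x; last exact: split_at (ip_proj_split embS gP d x) Px0 Pxx.
  have [Qx0|Qx0] := eqVneq (Q e x) 0; first by rewrite Pxx Qx0 raddf0.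
  have [Qxx|Qxx] := eqVneq (Q e x) x; first by rewrite Qxx Pxx Qxx.
  exact: split_at (ip_proj_split embS gQ e x) Qx0 Qxx.
have [Qx0|Qx0] := eqVneq (Q e x) 0; first by rewrite Px0 Qx0 !raddf0.
have [Qxx|Qxx] := eqVneq (Q e x) x; first by rewrite Qxx Px0 raddf0.
exact: split_at (ip_proj_split embS gQ e x) Qx0 Qxx.
Qed.

(** * Idempotents and roots of unity *)

Definition trivial_idempotents (R : comPzRingType) : Prop :=
  (1 : R) != 0 /\ forall e : R, e * e = e -> e = 0 \/ e = 1.

Lemma connected_trivial_idempotents (R : comPzRingType) :
  connected R -> trivial_idempotents R.
Proof.
move=> [x [y [xy idE]]].
have e0 : (0 : R) = x \/ (0 : R) = y by apply/idE; rewrite mul0r.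
have e1 : (1 : R) = x \/ (1 : R) = y by apply/idE; rewrite mul1r.
have neq01 : (1 : R) != 0.
  apply/eqP => z; apply: xy; rewrite -[x]mulr1 -[y]mulr1 z !mulr0 //.
split=> // e /idE ee; move: e0 e1 ee.
case=> [<-|<-] [e1|e1] [->|->]; auto; move: neq01; rewrite e1 ?eqxx //; auto.
Qed.

(** All conjugates of [z] have absolute value 1, so multiplication by [z ^+ m.-1], the inverse of
    [z], preserves the form. It maps [P d z] and [z - P d z] to an orthogonal pair [y], [1 - y];
    thus [y] is 0 or 1, and each component of [z] is 0 or [z]. *)
Lemma root_of_unity_homogeneous (R : comPzRingType) (D : finZmodType)
    (P : D -> {additive R -> R}) (z : R) (m : nat) :
    is_order R -> reduced R -> trivial_idempotents R -> pgrading P ->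
    (0 < m)%N -> z ^+ m = 1 -> exists d, P d z = z.
Proof.
move=> oR rR [neq01 idR] gP m_gt0 zm.
have [n [s embS]] := reduced_order_embeddings oR rR.
have zK : z * z ^+ m.-1 = 1 by rewrite -exprS prednK.
have norm_z k : `|s k z| = 1.
  apply/eqP; rewrite -(pexpr_eq1 (n := m)) // -normrX -rmorphXn zm rmorph1.
  by rewrite normr1.
have ipz x y : ip s (z ^+ m.-1 * x) (z ^+ m.-1 * y) = ip s x y.
  apply: eq_bigr => k _; rewrite !rmorphM mulrACA -normCK.
  by rewrite rmorphXn normrX norm_z !expr1n mul1r.
have P01 d : P d z = 0 \/ P d z = z.
  set y := z ^+ m.-1 * P d z.
  have zy : z * y = P d z by rewrite mulrA zK mul1r.
  have [|y0|y1] := idR y.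
  - apply: (ip_idempotent embS).
    have -> : 1 - y = z ^+ m.-1 * (z - P d z) by rewrite mulrBr -[_ * z]mulrC zK.
    by rewrite ipz (ip_proj_orth embS gP).
  - by left; rewrite -zy y0 mulr0.
  - by right; rewrite -zy y1 mulr1.
have [/existsP[d /eqP dz]|none] := boolP [exists d, P d z == z]; first by exists d.
case/eqP: neq01; rewrite -zK -(pgr_sum gP z) big1 ?mul0r // => d _.
by case: (P01 d) => // dz; case/existsP: none; exists d; rewrite dz.
Qed.

(* For an idempotent [x] with degree 0 part [a], the previous criterion applies
   to [x * a] and yields [a = x * a], an idempotent of degree 0. *)
Lemma trivial_idempotents_graded (R : comPzRingType) (D : finZmodType)
    (P : D -> {additive R -> R}) :
    is_order R -> reduced R -> pgrading P -> (1 : R) != 0 ->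
    (forall e, P 0 e = e -> e * e = e -> e = 0 \/ e = 1) ->
  trivial_idempotents R.
Proof.
move=> oR rR gP neq01 idP0; split=> // x xx.
have [n [s embS]] := reduced_order_embeddings oR rR.
have sx k : (s k x)^* = s k x.
  have /eqP : s k x * (1 - s k x) = 0 by rewrite mulrBr mulr1 -rmorphM xx subrr.
  by rewrite mulf_eq0 subr_eq0 => /orP[]/eqP => [->|<-]; rewrite ?conjC0 ?conjC1.
set a := P 0 x; pose y := x * a.
have ip_y1 : ip s y 1 = ip s a a.
  rewrite /a -(ip_projl embS gP) -/a; apply: eq_bigr => k _.
  by rewrite sx !rmorphM rmorph1 conjC1 mulr1 mulrC.
(* The conjugates of [x] are 0 or 1, so subtracting the form of [x * a] from that of [a] leaves the
   form of [(1 - x) * a], which is nonnegative. *)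
have ip_y : ip s y (1 - y) = ip s ((1 - x) * a) ((1 - x) * a).
  rewrite ipBr ip_y1 -sumrB; apply: eq_bigr => k _.
  have xk : s k x * s k x = s k x by rewrite -rmorphM xx.
  rewrite /y !rmorphM !rmorphB !rmorph1 /= !sx.
  set u := s k a; set c := s k x in xk *; set v := u^*.
  have -> : (1 - c) * u * ((1 - c) * v) = (1 - c - c + c * c) * (u * v) by ring.
  have -> : c * u * (c * v) = c * c * (u * v) by ring.
  by rewrite xk; ring.
have yy : y * y = y by apply: (ip_idempotent embS); rewrite ip_y ip_ge0.
(* Now that [y] is idempotent, its conjugates are 0 or 1 and the form vanishes; hence
   [(1 - x) * a = 0]. *)
have : ip s y (1 - y) = 0.
  apply: big1 => k _; have /eqP : s k y * (1 - s k y) = 0.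
    by rewrite mulrBr mulr1 -rmorphM yy subrr.
  rewrite mulf_eq0 subr_eq0 rmorphB rmorph1.
  by case/orP => /eqP => [->|<-]; rewrite ?mul0r // subrr conjC0 mulr0.
rewrite ip_y => /(ip_eq0 embS)/eqP; rewrite mulrBl mul1r subr_eq0 => /eqP ay.
have aa : a * a = a by rewrite [in RHS]ay -/y -yy /y -ay.
case: (idP0 a _ aa) => [|a0|a1]; first by rewrite /a pgr_id.
(* The form of [x] with itself equals its form with 1, which sees only the degree 0 part [a = 0]. *)
- left; apply: (ip_eq0 embS); transitivity (ip s (P 0 1) x).
    rewrite (pgr_one gP); apply: eq_bigr => k _.
    by rewrite rmorph1 mul1r sx -rmorphM xx.
  by rewrite (ip_projl embS gP) -/a a0 ip0r.
- by right; rewrite -[x]mulr1 -a1 -ay.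
Qed.

(** * Gradings and their projections *)

Lemma sum_extend_uniq (D : eqType) (V : nmodType) (ds l : seq D) (a : D -> V) :
    uniq ds -> uniq l -> {subset ds <= l} ->
  \sum_(d <- l) (if d \in ds then a d else 0) = \sum_(d <- ds) a d.
Proof.
move=> uds ul sub; rewrite -big_mkcond -big_filter; apply: perm_big.
apply: uniq_perm; rewrite ?filter_uniq // => d; rewrite mem_filter.
by case: (boolP (d \in ds)) => // /sub.
Qed.

(** Here [D] may be infinite, so each [x] comes with its own finite list of degrees, in contrast
    with [pgrading]. *)
Definition homog_projections (R : comPzRingType) (D : zmodType)
    (Ad : D -> R -> Prop) (P : D -> {additive R -> R}) : Prop :=
  [/\ forall x, exists2 ds : seq D, uniq ds & x = \sum_(d <- ds) P d x,
      forall d e x, P d (P e x) = if d == e then P e x else 0 &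
      forall d x, Ad d x <-> P d x = x].

(** A decomposition is chosen for every element and extended by 0 outside its list. Comparing
    decompositions on a common list makes the components additive and independent of the choice. *)
Lemma grading_projections (R : comPzRingType) (D : zmodType)
    (Ad : D -> R -> Prop) :
  grading Ad -> exists P : D -> {additive R -> R}, homog_projections Ad P.
Proof.
move=> [gsub gmul gex gun].
have A0 d : Ad d 0 by case: (gsub d).
have AB d x y : Ad d x -> Ad d y -> Ad d (x - y) by case: (gsub d) => _; apply.
have AD d x y : Ad d x -> Ad d y -> Ad d (x + y).
  by move=> xd yd; rewrite -[y]opprK -[- y]sub0r; apply: (AB _) => //; apply: (AB _).
pose rep (x : R) (da : seq D * (D -> R)) := [/\ uniq da.1,
  forall d, d \in da.1 -> Ad d (da.2 d) & x = \sum_(d <- da.1) da.2 d].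
pose ext (da : seq D * (D -> R)) d := if d \in da.1 then da.2 d else 0.
have extA x da d : rep x da -> Ad d (ext da d).
  by case=> _ ha _; rewrite /ext; case: ifP => // /ha.
have ext_sum x da l : rep x da -> uniq l -> {subset da.1 <= l} ->
    \sum_(d <- l) ext da d = x.
  by case=> u _ -> ul sub; rewrite sum_extend_uniq.
have ext_sub x y z dx dy dz : rep x dx -> rep y dy -> rep z dz -> z = x - y ->
    forall d, ext dz d = ext dx d - ext dy d.
  move=> rx ry rz zE d; pose l := undup (d :: dx.1 ++ dy.1 ++ dz.1).
  have sub (s : seq D) :
      (forall e, e \in s -> e \in d :: dx.1 ++ dy.1 ++ dz.1) -> {subset s <= l}.
    by move=> H e /H; rewrite mem_undup.
  have ul : uniq l by apply: undup_uniq.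
  apply/eqP; rewrite -subr_eq0; apply/eqP.
  apply: (gun l (fun e => ext dz e - (ext dx e - ext dy e))) => // [e _||].
  - by apply: (AB _); [exact: (extA _ _ _ rz)|];
      apply: (AB _); [exact: (extA _ _ _ rx)|exact: (extA _ _ _ ry)].
  - rewrite !sumrB (ext_sum _ _ l rx) ?(ext_sum _ _ l ry) ?(ext_sum _ _ l rz) ?zE ?subrr //;
      apply: (sub) => e es; rewrite inE !mem_cat es ?orbT //.
  by rewrite mem_undup mem_head.
have [c cP] : {c : R -> seq D * (D -> R) & forall x, rep x (c x)}.
  by apply: choice => x; have [ds [a H]] := gex x; exists (ds, a).
have cB d : zmod_morphism (fun x => ext (c x) d).
  by move=> x y; apply: (ext_sub x y (x - y)).
pose P d : {additive R -> R} :=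
  HB.pack (fun x => ext (c x) d) (GRing.isZmodMorphism.Build _ _ _ (cB d)).
have PA d x : Ad d (P d x) by apply: extA (cP x).
have rep1 d x : Ad d x -> rep x ([:: d], fun=> x).
  by move=> dx; split=> //= [e|]; rewrite ?big_seq1 // inE => /eqP->.
have rep0 : rep 0 ([::], fun=> 0) by split; rewrite //= big_nil.
have PE d e x : Ad e x -> P d x = if d == e then x else 0.
  move=> ex; have := ext_sub x 0 x _ _ _ (rep1 e x ex) rep0 (cP x) (esym (subr0 x)) d.
  by rewrite /ext /= !inE subr0.
exists P; split=> [x|d e x|d x].
- exists (c x).1; first by case: (cP x).
  rewrite -[LHS](ext_sum _ _ (c x).1 (cP x)) //; by case: (cP x).
- exact: PE.
by split=> [dx|<-]; rewrite ?(PE _ _ _ dx) ?eqxx.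
Qed.

Section HomogProjections.
Variables (R : comPzRingType) (D : zmodType).
Variables (Ad : D -> R -> Prop) (P : D -> {additive R -> R}).
Hypothesis hP : homog_projections Ad P.

Lemma hproj_proj d e x : P d (P e x) = if d == e then P e x else 0.
Proof. by case: hP. Qed.
Lemma hproj_mem d x : Ad d (P d x).
Proof. by case: hP => _ _ H; apply/H; rewrite hproj_proj eqxx. Qed.
Lemma hproj_id d x : Ad d x -> P d x = x.
Proof. by case: hP => _ _ H /H. Qed.
Lemma hproj_neq d e x : Ad e x -> d != e -> P d x = 0.
Proof. by move=> /hproj_id <- de; rewrite hproj_proj (negPf de). Qed.
Lemma hproj_eq0 x : (forall d, P d x = 0) -> x = 0.
Proof.
move=> x0; case: hP => /(_ x)[ds _ ->] _ _; rewrite big1 // => d _; exact: x0.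
Qed.

Lemma hproj_pgrading (D' : finZmodType) (Ad' : D' -> R -> Prop)
    (P' : D' -> {additive R -> R}) :
  grading Ad' -> homog_projections Ad' P' -> pgrading P'.
Proof.
move=> [_ gmul _ _] [ex pp H]; split=> // [x|d e x y].
  have [ds uds xE] := ex x; rewrite [RHS]xE (big_uniq _ uds) [RHS]big_mkcond /=.
  apply: eq_bigr => d _; case: ifP => // dds.
  rewrite xE raddf_sum big1_seq // => e /= eds; rewrite pp.
  by case: eqP => // de; rewrite de eds in dds.
by move=> /H dx /H ey; apply/H; apply: gmul.
Qed.

Lemma pushforwardP (E : zmodType) (t : D -> E) e x :
  pushforward Ad t e x <-> forall d, t d <> e -> P d x = 0.
Proof.
split=> [[ds [a [ha ->]]] d tde|H].
  rewrite raddf_sum big1_seq // => c /= cds; have [tc Ac] := ha c cds.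
  by apply: (hproj_neq Ac); apply/eqP => dc; apply: tde; rewrite dc.
case: hP => /(_ x)[ds _ xE] _ _.
exists [seq d <- ds | t d == e], (fun d => P d x); split.
  by move=> d; rewrite mem_filter => /andP[/eqP ? _]; split=> //; apply: hproj_mem.
rewrite big_filter [LHS]xE (bigID (fun d => t d == e)) /= [X in _ + X]big1 ?addr0 // => d.
by move=> /eqP; apply: H.
Qed.

Lemma pushforward_mem (E : zmodType) (t : D -> E) d x :
  Ad d x -> pushforward Ad t (t d) x.
Proof.
move=> dx; apply/pushforwardP => e te; apply: hproj_neq dx _.
by apply/eqP => ed; rewrite ed in te.
Qed.

End HomogProjections.

Lemma grading_pushforward (R : comPzRingType) (D E : zmodType)
    (Ad : D -> R -> Prop) (t : D -> E) :
  grading Ad -> ahom t -> grading (pushforward Ad t).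
Proof.
move=> gA tD; have [P hP] := grading_projections gA.
split=> [e|e e' x y|x|es a ues ha sum0 e ees].
- split=> [|x y]; first by apply/(pushforwardP hP) => d _; rewrite raddf0.
  move=> /(pushforwardP hP) Hx /(pushforwardP hP) Hy.
  by apply/(pushforwardP hP) => d de; rewrite raddfB Hx ?Hy ?subr0.
- move=> [ds [a [ha ->]]] [ds' [a' [ha' ->]]].
  apply/(pushforwardP hP) => c ce; rewrite mulr_suml raddf_sum big1_seq // => d /= dds.
  rewrite mulr_sumr raddf_sum big1_seq // => d' /= dds'.
  have [td Ad_] := ha d dds; have [td' Ad'] := ha' d' dds'.
  have Am : Ad (d + d') (a d * a' d') by case: gA => _ m _ _; apply: m.
  by apply: (hproj_neq hP Am); apply/eqP => cE; apply: ce; rewrite cE tD td td'.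
- have [ds uds xE] : exists2 ds, uniq ds & x = \sum_(d <- ds) P d x by case: hP.
  exists (undup (map t ds)), (fun e => \sum_(d <- ds | t d == e) P d x); split.
  + exact: undup_uniq.
  + move=> e _; exists [seq d <- ds | t d == e], (fun d => P d x); split.
      by move=> d; rewrite mem_filter => /andP[/eqP ? _]; split=> //; apply: (hproj_mem hP).
    by rewrite big_filter.
  rewrite [LHS]xE; under [RHS]eq_bigr do rewrite big_mkcond.
  rewrite exchange_big /= big_seq [RHS]big_seq; apply: eq_bigr => d dds.
  rewrite (bigD1_seq (t d)) ?undup_uniq ?mem_undup ?map_f //= eqxx big1 ?addr0 // => e.
  by rewrite eq_sym => /negPf->.
apply: (hproj_eq0 hP) => d; have [te|/eqP de] := eqVneq (t d) e; last first.
  by have /(pushforwardP hP)/(_ d de) := ha e ees.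
move: sum0 => /(congr1 (P d)); rewrite raddf0 raddf_sum /= (bigD1_seq e) //=.
rewrite big1_seq ?addr0 // => e' /andP[/= ne e'es].
have /(pushforwardP hP) := ha e' e'es; apply; apply/eqP.
by rewrite te eq_sym.
Qed.

(** * Units of a stark ring and their degrees *)

Lemma ahom_zmod_morphism (D E : zmodType) (f : D -> E) : ahom f -> zmod_morphism f.
Proof. by move=> fD x y; apply: (addIr (f y)); rewrite -fD !subrK. Qed.

(** By the pigeonhole principle the iterates are eventually periodic. The positive exponent [N.+1]
    lets one factor [e] be split off later. *)
Lemma iter_idempotent (T : finType) (e : T -> T) :
  exists N, forall x, iter N.+1 e (iter N.+1 e x) = iter N.+1 e x.
Proof.
pose F (k : 'I_(#|{ffun T -> T}|.+1)) := [ffun x => iter k.+1 e x].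
have /injectivePn[i [j ij Fij]] : ~~ injectiveb F.
  by apply/injectiveP => /leq_card; rewrite card_ord ltnn.
wlog lt_ij : i j ij Fij / (i < j)%N.
  move=> H; case: (ltngtP i j) => [|ji|/val_inj e0]; first exact: H.
    by apply: (H j i) => //; rewrite eq_sym.
  by rewrite e0 eqxx in ij.
have per x : iter j.+1 e x = iter i.+1 e x.
  by move/ffunP: Fij => /(_ x); rewrite !ffunE.
pose k := (j - i)%N.
have per1 a x : (i < a)%N -> iter (a + k) e x = iter a e x.
  move=> ia; have -> : (a + k = (a - i.+1) + j.+1)%N by rewrite /k; lia.
  by rewrite iterD per -iterD subnK.
have perm m a x : (i < a)%N -> iter (a + m * k) e x = iter a e x.
  move=> ia; elim: m => [|m IH]; first by rewrite mul0n addn0.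
  by rewrite mulSn addnA addnAC per1 ?IH // ltn_addr.
(* The exponent [i.+1 * k] lies beyond [i], where periodicity starts, and is a multiple of the
   period, so doubling it changes nothing. *)
have kN : (0 < i.+1 * k)%N by rewrite muln_gt0 subn_gt0.
exists (i.+1 * k).-1 => x; rewrite prednK // -iterD perm //.
by rewrite leq_pmulr // subn_gt0.
Qed.

(** For an idempotent [f] the fixed points are its image; as a type they can serve as the group of a
    group ring. *)
Record fixpoints (D : finZmodType) (f : {additive D -> D}) :=
  Fixpoints { fixval : D; _ : f fixval == fixval }.

Section Fixpoints.
Variables (D : finZmodType) (f : {additive D -> D}).
Definition fix_pred : {pred D} := fun x => f x == x.
Lemma fix_zmod_closed : zmod_closed fix_pred.
Proof.
split; rewrite ?inE /fix_pred ?raddf0 ?unfold_in ?eqxx ?raddf0 //.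
by move=> x y; rewrite !unfold_in raddfB => /eqP-> /eqP->.
Qed.
HB.instance Definition _ := [isSub of fixpoints f for @fixval D f].
HB.instance Definition _ := [Finite of fixpoints f by <:].
HB.instance Definition _ :=
  GRing.SubChoice_isSubZmodule.Build D fix_pred (fixpoints f) fix_zmod_closed.
End Fixpoints.

(** [stark_on] quantifies over coefficient rings that are types, so a subring given by a predicate
    is turned into one. *)
Record subring_type (R : comPzRingType) (S : R -> Prop) (sS : subring_of S) :=
  SubringElt { subring_val : R; _ : `[< S subring_val >] }.

Section SubringType.
Variables (R : comPzRingType) (S : R -> Prop) (sS : subring_of S).
Definition subring_pred : {pred R} := fun x => `[< S x >].
Lemma subring_pred_closed : subring_closed subring_pred.
Proof.
case: sS => S1 SB SM; split; rewrite ?unfold_in; first exact/asboolP.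
  by move=> x y; rewrite !unfold_in => /asboolP ? /asboolP ?; apply/asboolP/SB.
by move=> x y; rewrite !unfold_in => /asboolP ? /asboolP ?; apply/asboolP/SM.
Qed.
HB.instance Definition _ := [isSub of subring_type sS for @subring_val R S sS].
HB.instance Definition _ := [Choice of subring_type sS by <:].
HB.instance Definition _ :=
  GRing.SubChoice_isSubComPzRing.Build R subring_pred (subring_type sS) subring_pred_closed.
End SubringType.

Section StarkDegree.
Variables (R : comPzRingType) (S : R -> Prop) (D : finZmodType).
Variables (P : D -> {additive R -> R}) (b : D -> R) (e : D -> D).
Hypotheses (gP : pgrading P) (sS : subring_of S) (stS : stark_on S).
Hypothesis SP : forall d x, S x -> S (P d x).
Hypotheses (bM : mhom b) (Sb : forall d, S (b d)) (eD : ahom e).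
Hypothesis Pb : forall d, P (e d) (b d) = b d.

Let S_sum (I : Type) (r : seq I) (Q : pred I) (F : I -> R) :
  (forall i, Q i -> S (F i)) -> S (\sum_(i <- r | Q i) F i).
Proof.
case: sS => S1 SB _; have S0 : S 0 by rewrite -(subrr 1); apply: SB.
move=> SF; elim/big_ind: _ => // x y Sx Sy.
by rewrite -[y]opprK -[- y]sub0r; apply: (SB _ _ Sx); apply: SB.
Qed.

(* Let [f] be an idempotent power of [e] and [H] its image. If [d] is a nonzero
   fixed point of [e] then [H] is nontrivial, and precomposing [b] with a power
   of [e] gives units of [S] in all degrees [h] of [H] for the coarsened
   grading by [H], so [S] is a group ring over [H]. *)
Lemma stark_degree_fixpoint d : e d = d -> d = 0.
Proof.
move=> ed; apply/eqP; apply: contraT => d0; case: stS.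
have [N idN] := iter_idempotent e.
have itB k : zmod_morphism (iter k e).
  elim: k => [|k IH] x y //=; rewrite IH; exact: ahom_zmod_morphism.
pose f : {additive D -> D} := HB.pack (iter N.+1 e)
  (GRing.isZmodMorphism.Build _ _ _ (itB N.+1)).
pose fN : {additive D -> D} := HB.pack (iter N e)
  (GRing.isZmodMorphism.Build _ _ _ (itB N)).
pose u g := b (fN g).
have Pu g : P (f g) (u g) = u g by apply: Pb.
have ff g : f (f g) = f g by apply: idN.
have fd : f d = d by rewrite /= -iterS; elim: N.+1 => //= k ->.
clearbody f.
have u0 : u 0 = 1.
  by case: bM => b0 _; rewrite /u raddf0.
have uD g h : u (g + h) = u g * u h.
  by case: bM => _ bD; rewrite /u -bD raddfD.
have uN g : u (- g) * u g = 1 by rewrite -uD addNr.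
have Su g : S (u g) by apply: Sb.
(* The part of [S] of degree 0 for the grading coarsened along [f]; it becomes the coefficient
   ring. *)
pose C x := S x /\ forall g, f g != 0 -> P g x = 0.
have Psum I (r : seq I) (Q : pred I) (F : I -> R) g :
    (forall i, Q i -> P g (F i) = 0) -> P g (\sum_(i <- r | Q i) F i) = 0.
  by move=> F0; rewrite raddf_sum big1.
have sC : subring_of C.
  case: sS => S1 SB SM; split=> [|x y [Sx Cx] [Sy Cy]|x y [Sx Cx] [Sy Cy]].
  - split=> // g fg; apply: (pgr_neq gP (pgr_one gP)).
    by apply: contraNneq fg => ->; rewrite raddf0.
  - by split=> [|g fg]; [apply: SB|rewrite raddfB /= Cx // Cy // subr0].
  - split=> [|g fg]; first exact: SM.
    rewrite -(pgr_sum gP x) mulr_suml; apply: (Psum) => a _.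
    have [fa|fa] := eqVneq (f a) 0; last by rewrite Cx // mul0r raddf0.
    rewrite -(pgr_sum gP y) mulr_sumr; apply: (Psum) => c _.
    have [fc|fc] := eqVneq (f c) 0; last by rewrite Cy // mulr0 raddf0.
    apply: (pgr_neq gP (pgr_mul gP (pgr_id gP a x) (pgr_id gP c y))).
    by apply: contraNneq fg => ->; rewrite raddfD /= fa fc addr0.
have fH (h : fixpoints f) : f (val h) = val h by apply/eqP/(valP h).
exists (subring_type sC), (fixpoints f), val, (fun h => u (val h)); split; last first.
  have fdb : f d == d by rewrite fd.
  by exists (Fixpoints fdb : fixpoints f); rewrite -val_eqE.
have Cval (c : subring_type sC) : C (val c) by apply/asboolP/(valP c).
split.
- by split.
- by split=> [|x y] //; rewrite -uD.
- by split=> // c; case: (Cval c).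
- move=> r Sr.
  (* The component of [r] of coarse degree [h]. The unit [u (- val h)] moves it back to degree 0,
     into [C]. *)
  pose rh (h : fixpoints f) := \sum_(a | f a == val h) P a r.
  have Crh h : `[< C (rh h * u (- val h)) >].
    apply/asboolP; split; first by case: sS => _ _; apply=> //; apply: S_sum => a _; apply: SP.
    move=> g fg; rewrite mulr_suml; apply: (Psum) => a /eqP fa.
    apply: (pgr_neq gP (pgr_mul gP (pgr_id gP a r) (Pu _))).
    by apply: contraNneq fg => ->; rewrite raddfD /= !raddfN /= fa ?ff fH subrr.
  exists (index_enum (fixpoints f)), (fun h => SubringElt sC (Crh h)); split.
    exact: index_enum_uniq.
  under eq_bigr do rewrite -mulrA uN mulr1.
  rewrite (exchange_big_dep predT) //= -[LHS](pgr_sum gP); apply: eq_bigr => a _.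
  have faH : f (f a) == f a by rewrite ff.
  by rewrite (big_pred1 (Fixpoints faH)).
move=> hs c uhs sum0 h hhs.
pose w (h : fixpoints f) := val (c h) * u (val h).
have Pw (k : fixpoints f) g : f g != val k -> P g (w k) = 0.
  move=> fg; rewrite /w -(pgr_sum gP (val (c k))) mulr_suml; apply: (Psum) => a _.
  have [fa|fa] := eqVneq (f a) 0; last by case: (Cval (c k)) => _ ->; rewrite // mul0r raddf0.
  apply: (pgr_neq gP (pgr_mul gP (pgr_id gP a _) (Pu _))).
  by apply: contraNneq fg => ->; rewrite raddfD /= fa !fH add0r.
have w0 : w h = 0.
  rewrite -(pgr_sum gP (w h)) big1 // => g _.
  have [fg|/Pw//] := eqVneq (f g) (val h).
  move: sum0 => /(congr1 (P g)); rewrite raddf0 raddf_sum (bigD1_seq h) //= -/(w h).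
  rewrite big1 ?addr0 // => k kh; apply: Pw; rewrite fg.
  by rewrite eq_sym val_eqE.
apply/val_inj; rewrite -[LHS]mulr1 -(uN (val h)) mulrCA.
by rewrite -/(w h) w0 mulr0 raddf0.
Qed.

End StarkDegree.

(** * Group rings *)

Section SubringOf.
Variables (R : comPzRingType) (B : R -> Prop) (sB : subring_of B).
Lemma subring_of0 : B 0.
Proof. by case: sB => B1 BB _; rewrite -(subrr 1); apply: BB. Qed.
Lemma subring_ofB x y : B x -> B y -> B (x - y).
Proof. by case: sB => _ BB _; apply: BB. Qed.
Lemma subring_ofN x : B x -> B (- x).
Proof. by rewrite -sub0r; apply: subring_ofB; apply: subring_of0. Qed.
Lemma subring_ofD x y : B x -> B y -> B (x + y).
Proof. by move=> Bx By; rewrite -[y]opprK; apply: subring_ofB => //; apply: subring_ofN. Qed.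
Lemma subring_ofM x y : B x -> B y -> B (x * y).
Proof. by case: sB => _ _; apply. Qed.
Lemma subring_of_sum (I : Type) (r : seq I) (Q : pred I) (F : I -> R) :
  (forall i, Q i -> B (F i)) -> B (\sum_(i <- r | Q i) F i).
Proof. by move=> BF; elim/big_ind: _ => //; [apply: subring_of0|apply: subring_ofD]. Qed.
End SubringOf.

Section MHom.
Variables (H : zmodType) (R : comPzRingType) (phi : H -> R).
Hypothesis phiM : mhom phi.
Lemma mhom0 : phi 0 = 1. Proof. by case: phiM. Qed.
Lemma mhomD x y : phi (x + y) = phi x * phi y. Proof. by case: phiM. Qed.
Lemma mhomNK x : phi (- x) * phi x = 1. Proof. by rewrite -mhomD addNr mhom0. Qed.
Lemma mhomKN x : phi x * phi (- x) = 1. Proof. by rewrite -mhomD subrr mhom0. Qed.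
Lemma mhom_mulI x : injective (fun y => y * phi x).
Proof.
move=> y z /= /(congr1 (fun t => t * phi (- x))).
by rewrite -!mulrA mhomKN !mulr1.
Qed.
Lemma mhomMn x n : phi (x *+ n) = phi x ^+ n.
Proof. by elim: n => [|n IH]; rewrite ?mulr0n ?mhom0 // mulrS mhomD IH exprS. Qed.
End MHom.

Definition group_ring_basis (R : comPzRingType) (B : R -> Prop) (H : finZmodType)
    (phi : H -> R) : Prop :=
  [/\ subring_of B, mhom phi,
      forall r, exists c : H -> R, (forall h, B (c h)) /\ r = \sum_h c h * phi h &
      forall c : H -> R, (forall h, B (c h)) -> \sum_h c h * phi h = 0 ->
        forall h, c h = 0].

Definition graded_units (R : comPzRingType) (H : finZmodType)
    (P : H -> {additive R -> R}) (phi : H -> R) : Prop :=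
  [/\ pgrading P, mhom phi & forall h, P h (phi h) = phi h].

(** The components are the sets [B * phi h]. Through this grading the coefficient ring is recovered
    as the degree 0 part. *)
Lemma group_ring_basis_graded (R : comPzRingType) (B : R -> Prop)
    (H : finZmodType) (phi : H -> R) : group_ring_basis B phi ->
  exists P : H -> {additive R -> R},
    graded_units P phi /\ forall b, B b <-> P 0 b = b.
Proof.
move=> [sB phiM ex un]; pose Ad h x := exists b, B b /\ x = b * phi h.
have gA : grading Ad.
  split=> [h|g h _ _ [a [Ba ->]] [b [Bb ->]]|r|ds a uds ha sum0 h hds].
  - split=> [|_ _ [a [Ba ->]] [b [Bb ->]]].
      by exists 0; rewrite mul0r; split=> //; apply: subring_of0.
    by exists (a - b); rewrite mulrBl; split=> //; apply: subring_ofB.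
  - by exists (a * b); rewrite (mhomD phiM) mulrACA; split=> //; apply: subring_ofM.
  - have [c [Bc ->]] := ex r.
    exists (index_enum H), (fun h => c h * phi h); split=> // [|h _].
      exact: index_enum_uniq.
    by exists (c h).
  have /choice[c cP] k : exists b, B b /\ (if k \in ds then a k else 0) = b * phi k.
    case: ifP => [/ha//|_].
    by exists 0; rewrite mul0r; split=> //; apply: subring_of0.
  have c0 k : c k = 0.
    apply: (un c) => [g|]; first by case: (cP g).
    rewrite -[RHS]sum0 -(sum_extend_uniq a uds (index_enum_uniq H)).
      by apply: eq_bigr => g _; case: (cP g).
    by move=> g _; rewrite mem_index_enum.
  by case: (cP h); rewrite hds c0 mul0r.
have [P hP] := grading_projections gA; exists P.
split; first split=> //; first exact: (hproj_pgrading gA hP).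
  move=> h; apply: (hproj_id hP); exists 1; rewrite mul1r; split=> //.
  by case: sB.
move=> b; split=> [Bb|b0].
  by apply: (hproj_id hP); exists b; rewrite (mhom0 phiM) mulr1.
have : Ad 0 b by case: hP => _ _ ->.
by case=> c [Bc ->]; rewrite (mhom0 phiM) mulr1.
Qed.

Section GradedUnits.
Variables (R : comPzRingType) (H : finZmodType).
Variables (P : H -> {additive R -> R}) (phi : H -> R).
Hypotheses (gP : graded_units P phi) (neq01 : (1 : R) != 0).

Lemma graded_units_neq0 h : phi h != 0.
Proof.
have [_ phiM _] := gP; apply: contraNneq neq01 => h0.
by rewrite -(mhomNK phiM h) h0 mulr0.
Qed.
Lemma graded_units_inj : injective phi.
Proof.
have [gr _ Pphi] := gP; move=> g h gh.
by apply: (pgr_uniq gr (graded_units_neq0 g)); rewrite ?Pphi // gh Pphi.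
Qed.
End GradedUnits.

(** [in_D] indexes coefficients by elements of [R] instead of [G]. The translation uses injectivity
    of [phi]: the nonzero units [phi g] have distinct degrees. *)
Lemma in_D_group_ring_basis (R : comPzRingType) (B H : R -> Prop)
    (G : finZmodType) (phi : G -> R) : (1 : R) != 0 ->
  group_ring_basis B phi -> (forall r, H r <-> exists g, r = phi g) -> in_D B H.
Proof.
move=> neq01 gB HE; have [P [gP _]] := group_ring_basis_graded gB.
have phi_inj := graded_units_inj gP neq01.
have [sB phiM ex un] := gB.
have uphi : uniq (map phi (index_enum G)) by rewrite map_inj_uniq ?index_enum_uniq.
split=> //.
- split=> [|x y /HE[g ->] /HE[h ->]|x /HE[g ->]].
  + by apply/HE; exists 0; rewrite (mhom0 phiM).
  + by apply/HE; exists (g + h); rewrite (mhomD phiM).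
  + by exists (phi (- g)); rewrite (mhomKN phiM); split=> //; apply/HE; exists (- g).
- move=> r; have [c [Bc ->]] := ex r.
  exists (map phi (index_enum G)), (fun x => \sum_(g | phi g == x) c g); split=> //.
    move=> x /mapP[g _ ->]; split; first by apply/HE; exists g.
    by apply: subring_of_sum.
  rewrite big_map; apply: eq_bigr => g _; congr (_ * _).
  by rewrite (big_pred1 g) // => h /=; rewrite (inj_eq phi_inj).
move=> hs b uhs hb sum0 h hhs.
have /HE[g gE] : H h by case: (hb h hhs).
pose c k := if phi k \in hs then b (phi k) else 0.
have -> : b h = c g by rewrite /c -gE hhs.
apply: (un c) => [k|].
  by rewrite /c; case: ifP => [/hb[]//|_]; apply: subring_of0.
rewrite -[RHS]sum0 -(sum_extend_uniq (fun x => b x * x) uhs uphi).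
  by rewrite big_map; apply: eq_bigr => k _; rewrite /c; case: ifP; rewrite ?mul0r.
move=> x /hb[/HE[k ->] _]; apply/mapP; exists k => //; exact: mem_index_enum.
Qed.

Section UnitList.
Variables (R : comPzRingType) (hs : seq R).
Definition unit_list_closed : Prop :=
  [/\ 1 \in hs, forall x y, x \in hs -> y \in hs -> x * y \in hs &
      forall x, x \in hs -> exists y, y \in hs /\ x * y = 1].
(** A finite group of units, written additively so as to serve as a group of degrees. The closure
    proof is a parameter so that the group structure can be attached to the type. *)
Definition unit_list of unit_list_closed := seq_sub hs.
Variable hsP : unit_list_closed.
Local Notation U := (unit_list hsP).
HB.instance Definition _ := Finite.on U.
Definition ul_zero : U := SeqSub (let: And3 h _ _ := hsP in h).
Definition ul_add (x y : U) : U :=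
  SeqSub (let: And3 _ h _ := hsP in h _ _ (ssvalP x) (ssvalP y)).
Lemma ul_opp_subproof (x : U) : {y | y \in hs /\ ssval x * y = 1}.
Proof. by apply: cid; case: hsP => _ _; apply; apply: ssvalP. Qed.
Definition ul_opp (x : U) : U := SeqSub (proj1 (svalP (ul_opp_subproof x))).
Lemma ul_addA : associative ul_add.
Proof. by move=> x y z; apply/val_inj; rewrite /= mulrA. Qed.
Lemma ul_addC : commutative ul_add.
Proof. by move=> x y; apply/val_inj; rewrite /= mulrC. Qed.
Lemma ul_add0 : left_id ul_zero ul_add.
Proof. by move=> x; apply/val_inj; rewrite /= mul1r. Qed.
Lemma ul_addN : left_inverse ul_zero ul_opp ul_add.
Proof.
move=> x; apply/val_inj; rewrite /= mulrC.
by case: (svalP (ul_opp_subproof x)).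
Qed.
HB.instance Definition _ := GRing.isZmodule.Build U ul_addA ul_addC ul_add0 ul_addN.
End UnitList.

(* An order is finitely generated, hence so is [R] over [B] by finitely many
   elements of [H]; these already exhaust the basis [H]. *)
Lemma in_D_finite (R : comPzRingType) (B H : R -> Prop) :
    is_order R -> (1 : R) != 0 -> in_D B H ->
  exists hs : seq R, [/\ uniq hs, forall h, H h <-> h \in hs &
    forall r, exists b : R -> R, (forall h, B (b h)) /\ r = \sum_(h <- hs) b h * h].
Proof.
move=> /order_additive_bij[n [f [fi [fK fiK]]]] neq01 [sB sH ex un].
pose span hs r := exists b : R -> R, (forall h, B (b h)) /\ r = \sum_(h <- hs) b h * h.
have span0 hs : span hs 0.
  exists (fun=> 0); split=> [_|]; first exact: subring_of0.
  by rewrite big1 // => h _; rewrite mul0r.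
have spanB hs x y : span hs x -> span hs y -> span hs (x - y).
  move=> [a [Ba ->]] [b [Bb ->]]; exists (fun h => a h - b h).
  split=> [h|]; first exact: subring_ofB.
  by rewrite -sumrB; apply: eq_bigr => h _; rewrite mulrBl.
have spanS hs hs' x : uniq hs -> uniq hs' -> {subset hs <= hs'} -> span hs x -> span hs' x.
  move=> u u' sub [b [Bb ->]]; exists (fun h => if h \in hs then b h else 0).
  split=> [h|]; first by case: ifP => // _; apply: subring_of0.
  rewrite -(sum_extend_uniq (fun h => b h * h) u u' sub).
  by apply: eq_bigr => h _; case: ifP; rewrite ?mul0r.
have spanl (l : seq R) : exists hs, [/\ uniq hs, forall h, h \in hs -> H h &
    forall x, x \in l -> span hs x].
  elim: l => [|x l [hs [uhs Hhs sp]]]; first by exists [::].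
  have [hx [b [uhx hb xE]]] := ex x.
  have sub1 : {subset hs <= undup (hx ++ hs)}
    by move=> h hh; rewrite mem_undup mem_cat hh orbT.
  have sub2 : {subset hx <= undup (hx ++ hs)} by move=> h hh; rewrite mem_undup mem_cat hh.
  exists (undup (hx ++ hs)); split; first exact: undup_uniq.
    by move=> h; rewrite mem_undup mem_cat => /orP[/hb[]|/Hhs].
  move=> y; rewrite inE => /predU1P[->|/sp]; last by apply: spanS => //; apply: undup_uniq.
  apply: (spanS hx) => //; first exact: undup_uniq.
  exists (fun h => if h \in hx then b h else 0); split=> [h|].
    by case: ifP => [/hb[]//|_]; apply: subring_of0.
  by rewrite xE; apply: eq_big_seq => h ->.
have [hs [uhs Hhs sp]] := spanl [seq fi (delta_mx 0 i) | i : 'I_n].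
have spanD x y : span hs x -> span hs y -> span hs (x + y).
  by move=> sx sy; rewrite -[y]opprK -[- y]sub0r; apply: (spanB _ _ _ sx); apply: (spanB).
have spanN x : span hs x -> span hs (- x) by rewrite -sub0r; apply: spanB.
have span_all r : span hs r.
  rewrite -(fK r) (row_sum_delta (f r)) raddf_sum; elim/big_ind: _ => // i _.
  rewrite -(intz (f r 0 i)) scaler_int raddfMz.
  have si : span hs (fi (delta_mx 0 i)) by apply: sp; apply/mapP; exists i; rewrite ?mem_enum.
  have sn k : span hs (fi (delta_mx 0 i) *+ k).
    by elim: k => [|k IH]; rewrite ?mulr0n // mulrS; apply: spanD.
  by case: (f r 0 i) => k; [rewrite -pmulrn|rewrite NegzE mulrNz; apply: spanN; rewrite -pmulrn].
exists hs; split=> // h; split=> [Hh|]; last exact: Hhs.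
apply: contraT => nh; have [b [Bb hE]] := span_all h.
case/eqP: neq01.
(* Subtracting from [h] its expression over [hs] is a relation on [h :: hs] with coefficient 1 at
   [h]; freeness would make this coefficient 0. *)
pose c k := if k == h then 1 else - b k.
have := un (h :: hs) c; rewrite /= nh uhs => /(_ isT) H0.
rewrite -(H0 _ _ h (mem_head _ _)) /c ?eqxx // => [k|].
  rewrite inE; case: eqP => [-> _|_ /= /Hhs Hk]; split=> //; first by case: sB.
  exact: subring_ofN.
rewrite big_cons eqxx mul1r {1}hE -big_split big1_seq // => k /andP[_ ks] /=.
have [kh|_] := eqVneq k h; first by rewrite -kh ks in nh.
by rewrite mulNr subrr.
Qed.

Lemma in_D_typed (R : comPzRingType) (B H : R -> Prop) :
    is_order R -> (1 : R) != 0 -> in_D B H ->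
  exists (T : finZmodType) (phi : T -> R),
    group_ring_basis B phi /\ forall r, H r <-> exists h, r = phi h.
Proof.
move=> oR neq01 inD; have [hs [uhs HE ex]] := in_D_finite oR neq01 inD.
case: (inD) => sB [H1 HM HV] _ un.
have hsP : unit_list_closed hs.
  split=> [|x y /HE Hx /HE Hy|x /HE Hx]; [exact/HE|by apply/HE; apply: HM|].
  by have [y [Hy xy]] := HV x Hx; exists y; split=> //; apply/HE.
have sumE (F : R -> R) : \sum_(x : unit_list hsP) F (ssval x) = \sum_(h <- hs) F h.
  rewrite -(big_map (fun x : unit_list hsP => ssval x) predT F).
  apply: perm_big; apply: uniq_perm => //.
    by rewrite map_inj_uniq ?index_enum_uniq //; apply: val_inj.
  move=> h; apply/mapP/idP => [[x _ ->]|hh]; first exact: ssvalP.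
  by exists (SeqSub hh : unit_list hsP) => //; apply: mem_index_enum.
exists (unit_list hsP), (fun x => ssval x); split; last first.
  move=> r; split=> [/HE rh|[x ->]]; last by apply/HE/ssvalP.
  by exists (SeqSub rh : unit_list hsP).
split=> //.
- by move=> r; have [b [Bb ->]] := ex r; exists (fun x => b (ssval x));
    rewrite (sumE (fun h => b h * h)).
move=> c Bc sum0 x.
pose b h := \sum_(y : unit_list hsP | ssval y == h) c y.
have bE y : b (ssval y) = c y by rewrite /b (big_pred1 y).
rewrite -bE; apply: (un hs b uhs) (ssvalP x) => [h /HE Hh|].
  by split=> //; apply: subring_of_sum.
rewrite -(sumE (fun h => b h * h)) -[RHS]sum0.
by apply: eq_bigr => y _; rewrite bE.
Qed.

Lemma rhom_zmod_morphism (A R : comPzRingType) (f : A -> R) : rhom f -> zmod_morphism f.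
Proof. by case=> _ fD _; apply: ahom_zmod_morphism. Qed.

(** All eigenvalues vanish, so the characteristic polynomial is a power of ['X] and its second
    coefficient, minus the trace, is 0. *)
Lemma mxtrace_nilpotent n (N : 'M[algC]_n) m : N ^+ m = 0 -> \tr N = 0.
Proof.
case: n N => [|n] N Nm; first by rewrite /mxtrace big_ord0.
have [rs pE] := closed_field_poly_normal (char_poly N).
rewrite (monicP (char_poly_monic N)) scale1r in pE.
have rs0 : all (pred1 0) rs.
  apply/allP => a ars /=.
  have : root (char_poly N) a by rewrite pE root_prod_XsubC.
  rewrite -eigenvalue_root_char => /eigenvalueP[v vN v0].
  have : v *m N ^+ m = a ^+ m *: v.
    elim: m {Nm} => [|m IH]; first by rewrite !expr0 scale1r mulmx1.
    by rewrite !exprSr -[N ^+ m * N]/(N ^+ m *m N) mulmxA IH -scalemxAl vN scalerA.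
  rewrite Nm mulmx0 => /esym/eqP; rewrite scaler_eq0 (negPf v0) orbF.
  by rewrite expf_eq0 => /andP[].
have := @char_poly_trace _ n.+1 N isT; rewrite pE.
rewrite (eq_big_seq (fun=> 'X)) => [|z /(allP rs0)/eqP->]; last by rewrite subr0.
rewrite big_const_seq count_predT iter_mulr_1 coefXn.
have := congr1 (size : {poly algC} -> nat) pE; rewrite size_char_poly size_prod_XsubC => -[<-].
by rewrite ltn_eqF //= => /eqP; rewrite eq_sym oppr_eq0 => /eqP.
Qed.

Section GroupRing.
Variables (A R : comPzRingType) (G : finZmodType) (iota : A -> R) (j : G -> R).
Hypothesis AG : group_ring_on (fun _ : R => True) iota j.

Lemma group_ring_coef : exists cf : G -> {additive R -> A},
  (forall x, x = \sum_g iota (cf g x) * j g) /\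
  (forall c g, cf g (\sum_h iota (c h) * j h) = c g).
Proof.
case: AG => iM _ _ ex un; have iB := rhom_zmod_morphism iM.
have i0 : iota 0 = 0 by rewrite -(subrr 0) iB subrr.
have /choice[c cE] x : exists c : G -> A, x = \sum_g iota (c g) * j g.
  have [hs [c [uhs ->]]] := ex x I; exists (fun g => if g \in hs then c g else 0).
  rewrite -(sum_extend_uniq _ uhs (index_enum_uniq G)) => [|g _]; last exact: mem_index_enum.
  by apply: eq_bigr => g _; case: ifP; rewrite // i0 mul0r.
have cU (a : G -> A) g x : x = \sum_h iota (a h) * j h -> c x g = a g.
  move=> aE; apply/eqP; rewrite -subr_eq0; apply/eqP.
  apply: (un (index_enum G) (fun h => c x h - a h));
    rewrite ?index_enum_uniq ?mem_index_enum //.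
  transitivity (\sum_h iota (c x h) * j h - \sum_h iota (a h) * j h).
    by rewrite -sumrB; apply: eq_bigr => h _; rewrite iB mulrBl.
  by rewrite -cE -aE subrr.
have cB g : zmod_morphism (c^~ g).
  move=> x y; rewrite (cU (fun h => c x h - c y h)) // {1}(cE x) {1}(cE y) -sumrB.
  by apply: eq_bigr => h _; rewrite iB mulrBl.
pose K g : {additive R -> A} :=
  HB.pack (c^~ g) (GRing.isZmodMorphism.Build _ _ (c^~ g) (cB g)).
exists K.
by split=> [x|a g]; [apply: cE|apply: cU].
Qed.

Lemma group_ring_iota_inj : injective iota.
Proof.
have [cf [_ cfE]] := group_ring_coef; case: AG => iM jM _ _ _.
have iB := rhom_zmod_morphism iM.
have i0 : iota 0 = 0 by rewrite -(subrr 0) iB subrr.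
have cf0 a : cf 0 (iota a) = a.
  have := cfE (fun g => if g == 0 then a else 0) 0; rewrite eqxx => e.
  rewrite -[RHS]e (bigD1 0) //= eqxx (mhom0 jM) mulr1 big1 ?addr0 // => g /negPf->.
  by rewrite i0 mul0r.
by move=> a b ab; rewrite -(cf0 a) ab cf0.
Qed.

Lemma group_ring_on_basis : group_ring_basis (fun r => exists a, r = iota a) j.
Proof.
have [cf [cfx cfE]] := group_ring_coef; case: (AG) => iM jM _ _ _.
have iB := rhom_zmod_morphism iM; have [i1 _ iMul] := iM.
split=> //.
- split; first by exists 1.
    by move=> _ _ [a ->] [b ->]; exists (a - b).
  by move=> _ _ [a ->] [b ->]; exists (a * b).
- by move=> r; exists (fun g => iota (cf g r)); split=> // g; exists (cf g r).
move=> c /choice[a aE] sum0 g; rewrite aE -(cfE a g).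
under eq_bigr do rewrite -aE.
by rewrite sum0 raddf0 -(subrr 0) iB subrr.
Qed.

Lemma group_ring_order : is_order A -> is_order R.
Proof.
move=> /order_additive_bij[n [f [fi [fK fiK]]]].
have [cf [cfx cfE]] := group_ring_coef.
pose F x := mxvec (\matrix_(i < #|G|) f (cf (enum_val i) x)).
pose Fi v := \sum_g iota (fi (row (enum_rank g) (vec_mx v))) * j g.
exists (#|G| * n)%N, F; split=> [x y|].
  rewrite /F -raddfD; congr mxvec; apply/row_matrixP => i.
  by rewrite rowK [RHS]raddfD /= !rowK !raddfD.
exists Fi => [x|v]; rewrite /F /Fi.
  rewrite [RHS]cfx mxvecK; apply: eq_bigr => g _.
  by rewrite rowK enum_rankK fK.
apply: (can_inj vec_mxK); rewrite mxvecK; apply/row_matrixP => i.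
by rewrite rowK cfE enum_valK fiK.
Qed.

(* Over an embedding of [A], the group ring acts by group matrices, in which a
   nilpotent element has trace zero, that is, vanishing coefficient at 0. *)
Lemma group_ring_reduced : is_order A -> reduced A -> reduced R.
Proof.
move=> oA rA; have [n [s [s_inj _ _]]] := reduced_order_embeddings oA rA.
have [cf [cfx cfE]] := group_ring_coef; case: (AG) => [[i1 iD iMul] jM _ _ _].
have cfM g x a h : cf g (x * (iota a * j h)) = cf (g - h) x * a.
  rewrite -(cfE (fun k => cf (k - h) x * a) g); congr (cf g _).
  rewrite {1}(cfx x) mulr_suml [RHS](reindex_inj (addIr h)); apply: eq_bigr => k _ /=.
  by rewrite addrK iMul (mhomD jM) mulrACA.
have coef0 m x : x ^+ m = 0 -> cf 0 x = 0.
  move=> xm; apply: s_inj => k.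
  pose N y : 'M[algC]_#|G| := \matrix_(i, l) s k (cf (enum_val i - enum_val l) y).
  have NM y z : N (y * z) = N y * N z.
    apply/matrixP => i l; rewrite !mxE {1}(cfx z) mulr_sumr raddf_sum rmorph_sum /=.
    rewrite (reindex_inj (addIr (- enum_val l))) /=.
    transitivity (\sum_(g in G) s k (cf (enum_val i - g) y) * s k (cf (g - enum_val l) z)).
      by apply: eq_bigr => g _; rewrite cfM rmorphM opprB addrA addrNK.
    by rewrite big_enum_val; apply: eq_bigr => m' _; rewrite !mxE.
  have NX d : N (x ^+ d.+1) = N x ^+ d.+1.
    by elim: d => [|d IH]; rewrite // exprS NM IH -exprS.
  (* [NX] covers positive exponents only, hence [m.+1]. *)
  have /mxtrace_nilpotent : N x ^+ m.+1 = 0.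
    by rewrite -NX exprS xm mulr0; apply/matrixP => i l; rewrite !mxE !raddf0.
  rewrite /mxtrace (eq_bigr (fun=> s k (cf 0 x))) => [|i _]; last by rewrite mxE subrr.
  rewrite sumr_const card_ord => /eqP; rewrite mulrn_eq0 => /orP[|/eqP//].
  by move/eqP/card0_eq/(_ 0).
move=> x m xm; rewrite (cfx x) big1 // => g _.
have -> : cf g x = 0; last by rewrite -(subrr 0) (ahom_zmod_morphism iD) subrr mul0r.
(* The coefficient of [x] at [g] is the coefficient at 0 of [x * j (- g)], which is nilpotent
   too. *)
have := cfM 0 x 1 (- g); rewrite i1 mul1r opprK add0r mulr1 => <-.
by apply: (coef0 m); rewrite exprMn xm mul0r.
Qed.

End GroupRing.

(** A group ring structure on the image pulls back to [A] along the injective [theta]. *)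
Lemma stark_image (A R : comPzRingType) (theta : A -> R) :
  rhom theta -> injective theta -> stark A -> stark_on (fun r => exists a, r = theta a).
Proof.
move=> tM tI stA [C [H [f [phi [[fM phiM [Sf Sphi] ex un] nt]]]]]; apply: stA.
have tB := rhom_zmod_morphism tM; have [t1 tD tMul] := tM.
have [f' fE] := choice Sf; have [phi' phiE] := choice Sphi.
have tS hs (c : H -> C) : theta (\sum_(h <- hs) f' (c h) * phi' h) =
    \sum_(h <- hs) f (c h) * phi h.
  elim: hs => [|h hs IH]; rewrite ?big_nil ?big_cons; first by rewrite -(subrr 0) tB subrr.
  by rewrite tD tMul IH -fE -phiE.
have [f1 fD fMul] := fM; have [phi0 phiD] := phiM.
exists C, H, f', phi'; split=> //; split=> //.
- split=> [|x y|x y]; apply: tI; first by rewrite -fE f1 t1.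
    by rewrite tD -!fE fD.
  by rewrite tMul -!fE fMul.
- split=> [|x y]; apply: tI; first by rewrite -phiE phi0 t1.
  by rewrite tMul -!phiE phiD.
- move=> r _; have [|hs [c [uhs rE]]] := ex (theta r); first by exists r.
  by exists hs, c; split=> //; apply: tI; rewrite tS.
move=> hs c uhs sum0; apply: un => //; rewrite -tS sum0.
by rewrite -(subrr 0) tB subrr.
Qed.

(** * Degree homomorphisms between the two groups *)

Lemma degree_hom (R : comPzRingType) (D E : finZmodType)
    (P : D -> {additive R -> R}) (psi : E -> R) :
    is_order R -> reduced R -> trivial_idempotents R -> pgrading P -> mhom psi ->
  exists p : E -> D, ahom p /\ forall h, P (p h) (psi h) = psi h.
Proof.
move=> oR rR tiR gP psiM.
have /choice[p pP] h : exists d, P d (psi h) = psi h.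
  (* Each [psi h] is a root of unity, because [#|E|] annihilates [h]. *)
  apply: (root_of_unity_homogeneous (m := #|E|) oR rR tiR gP).
    by apply/card_gt0P; exists 0.
  by rewrite -(mhomMn psiM) mulrn_card (mhom0 psiM).
exists p; split=> // x y; apply: (pgr_uniq gP (x := psi (x + y))) => //.
  case: tiR => neq01 _; apply: contraNneq neq01 => h0.
  by rewrite -(mhomNK psiM (x + y)) h0 mulr0.
by rewrite (mhomD psiM); apply: pgr_mul.
Qed.

(* If [q d = 0] then [d] is a fixed point of [d |-> d - p (q d)], which is the
   [P]-degree of the unit [phi d * psi (- q d)] of the degree 0 part of [Q]. *)
Lemma stark_degree_inj (R : comPzRingType) (D E : finZmodType)
    (P : D -> {additive R -> R}) (Q : E -> {additive R -> R})
    (phi : D -> R) (psi : E -> R) (p : E -> D) (q : D -> E) :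
    is_order R -> reduced R -> graded_units P phi -> graded_units Q psi ->
    stark_on (fun r => Q 0 r = r) ->
    ahom p -> ahom q -> (forall h, P (p h) (psi h) = psi h) ->
    (forall g, Q (q g) (phi g) = phi g) ->
  injective q.
Proof.
move=> oR rR [gP phiM Pphi] [gQ psiM Qpsi] st pD qD Ppsi Qphi.
have pB := ahom_zmod_morphism pD; have qB := ahom_zmod_morphism qD.
have q0 : q 0 = 0 by rewrite -(subrr 0) qB subrr.
have p0 : p 0 = 0 by rewrite -(subrr 0) pB subrr.
have pN x : p (- x) = - p x by rewrite -[- x]sub0r pB p0 sub0r.
have sS : subring_of (fun r => Q 0 r = r).
  split=> [|x y Qx Qy|x y Qx Qy]; first exact: pgr_one.
    by rewrite raddfB Qx Qy.
  by rewrite -[X in Q X](addr0 0); apply: pgr_mul.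
have fixq d : q d = 0 -> d = 0.
  move=> qd; apply: (stark_degree_fixpoint (b := fun g => phi g * psi (- q g))
    (e := fun g => g - p (q g)) gP sS st).
  - by move=> g x Qx; rewrite -(pgradings_commute oR rR gP gQ) Qx.
  - split=> [|x y]; first by rewrite (mhom0 phiM) q0 oppr0 (mhom0 psiM) mulr1.
    by rewrite (mhomD phiM) qD opprD (mhomD psiM) mulrACA.
  - by move=> g; rewrite -(subrr (q g)); apply: pgr_mul.
  - by move=> x y; rewrite qD pD opprD addrACA.
  - by move=> g; rewrite -pN; apply: pgr_mul.
  by rewrite qd p0 subr0.
by move=> x y xy; apply/eqP; rewrite -subr_eq0; apply/eqP/fixq; rewrite qB xy subrr.
Qed.

(** * Twisted subrings *)

Section Twist.
Variables (A R : comPzRingType) (G : finZmodType) (iota : A -> R) (j : G -> R).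
Hypothesis AG : group_ring_on (fun _ : R => True) iota j.
Variable T : G -> {additive A -> A}.
Hypothesis gT : pgrading T.

(** The embedding that multiplies the degree [g] part by [j g]. For the pushforward grading along
    [t] its image is the ring [A_t]. *)
Definition twist (a : A) : R := \sum_g iota (T g a) * j g.

Let iM : rhom iota. Proof. by case: AG. Qed.
Let jM : mhom j. Proof. by case: AG. Qed.
Let iB := rhom_zmod_morphism iM.
Let i1 : iota 1 = 1. Proof. by case: iM. Qed.
Let iD x y : iota (x + y) = iota x + iota y. Proof. by case: iM. Qed.
Let iMul x y : iota (x * y) = iota x * iota y. Proof. by case: iM. Qed.
Let i0 : iota 0 = 0. Proof. by rewrite -(subrr 0) iB subrr. Qed.
Let i_sum (I : Type) (r : seq I) (Q : pred I) (F : I -> A) :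
  iota (\sum_(i <- r | Q i) F i) = \sum_(i <- r | Q i) iota (F i).
Proof. exact: (big_morph iota iD i0). Qed.

Lemma twistD x y : twist (x + y) = twist x + twist y.
Proof. by rewrite -big_split; apply: eq_bigr => g _; rewrite raddfD iD mulrDl. Qed.

Lemma twist0 : twist 0 = 0.
Proof. by rewrite /twist big1 // => g _; rewrite raddf0 i0 mul0r. Qed.

Lemma twist_sum (I : Type) (r : seq I) (F : I -> A) :
  twist (\sum_(i <- r) F i) = \sum_(i <- r) twist (F i).
Proof. exact: (big_morph twist twistD twist0). Qed.

Lemma twist_homogeneous g x : T g x = x -> twist x = iota x * j g.
Proof.
move=> gx; rewrite /twist (bigD1 g) //= gx big1 ?addr0 // => h hg.
by rewrite (pgr_neq gT gx hg) i0 mul0r.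
Qed.

Lemma rhom_twist : rhom twist.
Proof.
split; last 1 first.
- move=> x y; rewrite -(pgr_sum gT x) mulr_suml !twist_sum mulr_suml.
  apply: eq_bigr => g _; rewrite -(pgr_sum gT y) mulr_sumr !twist_sum mulr_sumr.
  apply: eq_bigr => h _.
  rewrite (twist_homogeneous (pgr_mul gT (pgr_id gT g x) (pgr_id gT h y))).
  rewrite (twist_homogeneous (pgr_id gT g x)) (twist_homogeneous (pgr_id gT h y)).
  by rewrite iMul (mhomD jM) mulrACA.
- by rewrite (twist_homogeneous (pgr_one gT)) i1 (mhom0 jM) mulr1.
exact: twistD.
Qed.

Lemma twist_inj : injective twist.
Proof.
have [cf [_ cfE]] := group_ring_coef AG.
move=> x y xy; rewrite -(pgr_sum gT x) -(pgr_sum gT y); apply: eq_bigr => g _.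
by rewrite -(cfE (T^~ x) g) -(cfE (T^~ y) g) -/(twist x) xy.
Qed.

Lemma twist_span r : exists b : G -> A, r = \sum_k twist (b k) * j k.
Proof.
have [cf [cfx _]] := group_ring_coef AG.
(* For [a] of degree [d], [iota a * j g] equals [twist a * j (g - d)], so it is collected at
   [k = g - d]. *)
exists (fun k => \sum_d T d (cf (k + d) r)).
transitivity (\sum_k \sum_d iota (T d (cf (k + d) r)) * j (k + d)); last first.
  apply: eq_bigr => k _; rewrite twist_sum mulr_suml; apply: eq_bigr => d _.
  by rewrite (twist_homogeneous (pgr_id gT _ _)) -mulrA -(mhomD jM) addrC.
rewrite exchange_big /= {1}(cfx r).
transitivity (\sum_g \sum_d iota (T d (cf g r)) * j g).
  by apply: eq_bigr => g _; rewrite -mulr_suml -i_sum (pgr_sum gT).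
rewrite exchange_big; apply: eq_bigr => d _ /=.
by rewrite (reindex_inj (addIr d)).
Qed.

Lemma twist_free (b : G -> A) :
  \sum_k twist (b k) * j k = 0 -> forall k, b k = 0.
Proof.
have [cf [_ cfE]] := group_ring_coef AG => sum0.
(* This is the coefficient at [m] of the vanishing sum. Its summands have distinct degrees, so
   taking [m = k + d] isolates [T d (b k)]. *)
have Tb m : \sum_d T d (b (m - d)) = 0.
  rewrite -(cfE (fun m => \sum_d T d (b (m - d))) m).
  suff -> : \sum_h iota (\sum_d T d (b (h - d))) * j h = 0 by rewrite raddf0.
  rewrite -[RHS]sum0.
  under eq_bigr do rewrite i_sum mulr_suml.
  rewrite exchange_big /=.
  transitivity (\sum_d \sum_k iota (T d (b k)) * j (k + d)).
    apply: eq_bigr => d _; rewrite (reindex_inj (addIr d)); apply: eq_bigr => k _ /=.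
    by rewrite addrK.
  rewrite exchange_big; apply: eq_bigr => k _; rewrite /twist mulr_suml.
  by apply: eq_bigr => d _; rewrite addrC (mhomD jM) mulrA.
move=> k; rewrite -(pgr_sum gT (b k)) big1 // => d _.
have := congr1 (T d) (Tb (k + d)); rewrite raddf0 raddf_sum (bigD1 d) //= addrK pgr_id //.
by rewrite big1 ?addr0 // => e ed; rewrite (pgr_proj gT) eq_sym (negPf ed).
Qed.

Lemma A_t_twist (Gam : zmodType) (Ag : Gam -> A -> Prop) (t : Gam -> G) :
    grading Ag -> (forall e x, pushforward Ag t e x <-> T e x = x) ->
  forall r, A_t Ag iota j t r <-> exists a, r = twist a.
Proof.
move=> gA TE r; have [P hP] := grading_projections gA.
have tw d x : Ag d x -> twist x = iota x * j (t d).
  by move=> dx; apply: twist_homogeneous; apply/TE; apply: (pushforward_mem hP).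
split=> [[gs [a [ugs ha ->]]]|[a ->]].
  exists (\sum_(d <- gs) a d); rewrite twist_sum big_seq [RHS]big_seq.
  by apply: eq_bigr => d /ha /tw ->.
have [ds uds aE] : exists2 ds, uniq ds & a = \sum_(d <- ds) P d a by case: hP.
exists ds, (P^~ a); split=> // [d _|]; first exact: (hproj_mem hP).
rewrite {1}aE twist_sum; apply: eq_bigr => d _; apply: tw; exact: (hproj_mem hP).
Qed.

End Twist.

Lemma pushforward_pgrading (A : comPzRingType) (Gam : zmodType) (G : finZmodType)
    (Ag : Gam -> A -> Prop) (t : Gam -> G) : grading Ag -> ahom t ->
  exists T : G -> {additive A -> A},
    pgrading T /\ forall e x, pushforward Ag t e x <-> T e x = x.
Proof.
move=> gA tD; have gpf := grading_pushforward gA tD.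
have [T hT] := grading_projections gpf; exists T.
by split; [apply: (hproj_pgrading gpf hT)|case: hT].
Qed.

Lemma order_trivial_idempotents (A R : comPzRingType) (G : finZmodType)
    (iota : A -> R) (j : G -> R) (P : G -> {additive R -> R}) :
    group_ring_on (fun _ : R => True) iota j -> is_order R -> reduced R ->
    trivial_idempotents A -> pgrading P ->
    (forall b, (exists a, b = iota a) <-> P 0 b = b) ->
  trivial_idempotents R.
Proof.
move=> AG oR rR [neq01 idA] gP PE; have iI := group_ring_iota_inj AG.
have iM : rhom iota by case: AG.
have iB := rhom_zmod_morphism iM; have [i1 _ iMul] := iM.
have i0 : iota 0 = 0 by rewrite -(subrr 0) iB subrr.
apply: (trivial_idempotents_graded oR rR gP).
  by rewrite -i1 -i0 (inj_eq iI).
move=> _ /PE[a ->] aa; case: (idA a) => [|->|->]; rewrite ?i0 ?i1; auto.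
by apply: iI; rewrite iMul.
Qed.

(** * The two inclusions *)

Section Main.
Variables (A : comPzRingType) (Gam : zmodType) (Ag : Gam -> A -> Prop).
Variables (G : finZmodType) (R : comPzRingType) (iota : A -> R) (j : G -> R).
Hypotheses (oA : is_order A) (rA : reduced A) (cA : connected A) (stA : stark A).
Hypothesis uA : universal_grading Ag.
Hypothesis AG : group_ring_on (fun _ : R => True) iota j.
Variables (B H : R -> Prop).

Let tiA := connected_trivial_idempotents cA.
Let oR := group_ring_order AG oA.
Let rR := group_ring_reduced AG oA rA.
Let iM : rhom iota. Proof. by case: AG. Qed.
Let jM : mhom j. Proof. by case: AG. Qed.
Let iI := group_ring_iota_inj AG.
Let iB := rhom_zmod_morphism iM.
Let i1 : iota 1 = 1. Proof. by case: iM. Qed.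
Let iD x y : iota (x + y) = iota x + iota y. Proof. by case: iM. Qed.
Let iMul x y : iota (x * y) = iota x * iota y. Proof. by case: iM. Qed.
Let i0 : iota 0 = 0. Proof. by rewrite -(subrr 0) iB subrr. Qed.
Let neq01 : (1 : R) != 0.
Proof. by case: tiA => n01 _; rewrite -i1 -i0 (inj_eq iI). Qed.

(** If [s g] has degree [d g], then [iota (s g) * j g] is the unit [theta (s g)] times
    [j (g - d g)]. The twisted group is thus the basis [j] over the image of [theta], permuted and
    rescaled by units. *)
Lemma stark_basis_twisted (t : Gam -> G) (s : G -> A) :
    ahom t -> (forall r, B r <-> A_t Ag iota j t r) ->
    mhom s -> (forall r, H r <-> H_s iota j s r) ->
  in_D B H /\ stark_on B.
Proof.
move=> tD BE sM HE; have gA : grading Ag by case: uA.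
have [T [gT TE]] := pushforward_pgrading gA tD.
pose theta := twist iota j T.
have thM : rhom theta := rhom_twist AG gT.
have thI : injective theta := twist_inj AG gT.
have {}BE r : B r <-> exists a, r = theta a.
  by rewrite BE; apply: (A_t_twist AG gT gA TE).
split; last first.
  have -> : B = (fun r => exists a, r = theta a) by apply/funext => r; apply/propext.
  exact: stark_image.
have [d [dD dP]] := degree_hom oA rA tiA gT sM.
have dB := ahom_zmod_morphism dD.
have eps_inj : injective (fun g => g - d g).
  (* The kernel of [g - d g] consists of fixed points of [d], and the units [s g] of the stark ring
     [A] have degrees [d g]. *)
  have fixd g : d g = g -> g = 0.
    apply: (stark_degree_fixpoint (S := fun=> True) gT _ stA _ sM _ dD dP) => //.
  move=> g h /= gh; apply/eqP; rewrite -subr_eq0; apply/eqP/fixd; rewrite dB.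
  have key (x y z w : G) : x - y = z - w -> y - w = x - z.
    by move=> E; rewrite -[x](subrK y) E addrAC [z - w - z]addrAC subrr sub0r addrC.
  exact: key.
pose phi g := iota (s g) * j g.
have phiE g : phi g = theta (s g) * j (g - d g).
  rewrite /theta (twist_homogeneous AG gT (dP g)) -mulrA -(mhomD jM).
  by rewrite addrC subrK.
have [th1 thD thMul] := thM.
have ths g : theta (s (- g)) * theta (s g) = 1 by rewrite -thMul (mhomNK sM).
apply: (@in_D_group_ring_basis _ _ _ G phi) => //.
split=> [|||c Bc sum0 g].
- split; first by apply/BE; exists 1.
    by move=> _ _ /BE[a ->] /BE[b ->]; apply/BE; exists (a - b);
      rewrite (rhom_zmod_morphism thM).
  by move=> _ _ /BE[a ->] /BE[b ->]; apply/BE; exists (a * b); rewrite thMul.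
- split=> [|x y]; first by rewrite /phi (mhom0 sM) (mhom0 jM) i1 mulr1.
  by rewrite /phi (mhomD sM) (mhomD jM) iMul mulrACA.
- move=> r; have [b ->] := twist_span AG gT r.
  (* The factor [s (- g)] cancels the unit [theta (s g)] in [phi g]. *)
  exists (fun g => theta (b (g - d g) * s (- g))); split=> [g|].
    by apply/BE; eexists.
  rewrite (reindex_inj eps_inj); apply: eq_bigr => g _ /=.
  by rewrite phiE mulrA; congr (_ * _); rewrite thMul -mulrA ths mulr1.
have /choice[a aE] k : exists a, c k = theta a by apply/BE.
have [ei eiK Kei] := injF_bij eps_inj.
have x0 : a g * s g = 0.
  have := twist_free AG gT (b := fun k => a (ei k) * s (ei k)) _ (g - d g).
  rewrite eiK; apply; rewrite (reindex_inj eps_inj) -[RHS]sum0.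
  apply: eq_bigr => k _ /=; rewrite eiK -/(theta _) thMul -aE phiE mulrA //.
by rewrite aE -[a g]mulr1 -(mhomKN sM g) mulrA x0 mul0r
  -(subrr 0) (rhom_zmod_morphism thM) subrr.
Qed.

Lemma stark_basis_degrees : in_D B H -> stark_on B ->
  (exists t : Gam -> G, ahom t /\ forall r, B r <-> A_t Ag iota j t r) /\
  (exists s : G -> A, (mhom s /\ forall g, mu_elt (s g)) /\
                      forall r, H r <-> H_s iota j s r).
Proof.
move=> inD stB; have gA : grading Ag by case: uA.
have [P [gPj PE]] := group_ring_basis_graded (group_ring_on_basis AG).
have [E [psi [gB HE]]] := in_D_typed oR neq01 inD.
have [Q [gQpsi QE]] := group_ring_basis_graded gB.
have [[gP _ Pj] [gQ psiM Qpsi]] := (gPj, gQpsi).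
have tiR := order_trivial_idempotents AG oR rR tiA gP PE.
have [p [pD pP]] := degree_hom oR rR tiR gP psiM.
have [q [qD qP]] := degree_hom oR rR tiR gQ jM.
have PQ := pgradings_commute oR rR gP gQ.
have q_inj : injective q.
  apply: (stark_degree_inj oR rR gPj gQpsi _ pD qD pP qP).
  by have <- : B = (fun r => Q 0 r = r) by apply/funext => r; apply/propext.
have p_inj : injective p.
  apply: (stark_degree_inj oR rR gQpsi gPj _ qD pD qP pP).
  have <- : (fun r => exists a, r = iota a) = (fun r => P 0 r = r).
    by apply/funext => r; apply/propext.
  exact: stark_image.
have pB := ahom_zmod_morphism pD; have qB := ahom_zmod_morphism qD.
have qN g : q (- g) = - q g.
  by have := qB 0 g; rewrite !sub0r => ->; rewrite -{1}(subrr 0) qB subrr sub0r.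
have pN g : p (- g) = - p g.
  by have := pB 0 g; rewrite !sub0r => ->; rewrite -{1}(subrr 0) pB subrr sub0r.
(* Injections in both directions between finite groups are bijective. *)
have [pi piK Kpi] : bijective p by apply: inj_card_bij p_inj (leq_card q q_inj).
have [qi qiK Kqi] : bijective q by apply: inj_card_bij q_inj (leq_card p p_inj).
have piD x y : pi (x + y) = pi x + pi y.
  by apply: p_inj; rewrite pD !Kpi.
split.
(* The sign is chosen so that [iota a * j g] has [Q]-degree 0, that is, lies in [B], exactly when
   [a] has degree [g]. Universality of the grading then supplies [t]. *)
- pose Ae g a := Q (- q g) (iota a) = iota a.
  have QiA h a : exists a', Q h (iota a) = iota a'.
    by apply/PE; rewrite PQ; congr (Q h _); apply/PE; exists a.
  have gAe : grading Ae.
    split=> [g|g h x y gx hy|a|ds a uds ha sum0 g gds].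
    + split=> [|x y gx gy]; first by rewrite /Ae i0 raddf0.
      by rewrite /Ae iB raddfB /= gx gy.
    + by rewrite /Ae qD opprD iMul; apply: pgr_mul.
    + have /choice[c cE] g := QiA (- q g) a.
      exists (index_enum G), c; split; first exact: index_enum_uniq.
        by move=> g _; rewrite /Ae -cE pgr_id.
      apply: iI; rewrite (big_morph iota iD i0) -(pgr_sum gQ (iota a)).
      have nq_inj : injective (fun g => - q g) by move=> x y /oppr_inj/q_inj.
      (* Surjectivity of [q] ensures that every [Q]-degree is some [- q g], so no component of [a]
         is lost. *)
      rewrite (reindex (fun g => - q g)); first by apply: eq_bigr => g _; rewrite cE.
      exists (fun h => qi (- h)) => h _; first by rewrite opprK qiK.
      by rewrite Kqi opprK.
    apply: iI; rewrite i0; have := congr1 (fun x => Q (- q g) (iota x)) sum0.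
    rewrite /= i0 raddf0 (big_morph iota iD i0) raddf_sum (bigD1_seq g) //= ha //.
    rewrite big1_seq ?addr0 // => h /andP[hg hds].
    apply: (pgr_neq gQ (ha h hds)); rewrite eqr_opp (inj_eq q_inj) eq_sym //.
  case: uA => _ /(_ G Ae gAe)[t [tD tE _]]; exists t; split=> //.
  have [T [gT TE]] := pushforward_pgrading gA tD.
  have TAe g a : T g a = a <-> Q (- q g) (iota a) = iota a.
    by rewrite -TE -tE.
  move=> r; rewrite (A_t_twist AG gT gA TE).
  split=> [/QE Qr|[a ->]]; last first.
    have [sB _ _ _] := gB; apply: (subring_of_sum sB) => g _; apply/QE.
    rewrite -(addNr (q g)); apply: (pgr_mul gQ) => //.
    by apply/TAe; apply: pgr_id.
  (* The gradings commute, so the [P]-components of an element of [B] stay in [B]; dividing the one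
     of degree [g] by [j g] leaves an element of [A] of degree [g]. *)
  have /choice[a aE] g : exists a, P g r = iota a * j g /\ T g a = a.
    have [a aE] : exists a, P g r * j (- g) = iota a.
      have [|a ->] := (PE (P g r * j (- g))).2; last by exists a.
      by rewrite -(subrr g); apply: (pgr_mul gP); rewrite ?pgr_id.
    exists a; split; first by rewrite -aE -mulrA (mhomNK jM) mulr1.
    apply/TAe; rewrite -aE -[X in Q X]add0r -qN; apply: (pgr_mul gQ) => //.
    by rewrite -PQ Qr.
  exists (\sum_g a g); rewrite (twist_sum AG) -[LHS](pgr_sum gP).
  by apply: eq_bigr => g _; have [-> Ta] := aE g; rewrite (twist_homogeneous AG gT Ta).
have /choice[s0 s0E] h : exists a, psi h * j (- p h) = iota a.
  have [|a ->] := (PE (psi h * j (- p h))).2; last by exists a.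
  by rewrite -(subrr (p h)); apply: (pgr_mul gP).
(* The element of the second group with [P]-degree [g] is [psi (pi g)], and [s g] is its coefficient
   in [A]. *)
pose s g := s0 (pi g).
have sE g : iota (s g) * j g = psi (pi g).
  by rewrite /s -s0E Kpi -mulrA (mhomNK jM) mulr1.
have sM : mhom s.
  split=> [|x y]; apply: iI.
    apply: (mhom_mulI jM (x := 0)); rewrite /= sE i1 mul1r (mhom0 jM).
    have -> : pi 0 = 0 by apply: (addIr (pi 0)); rewrite -piD !add0r.
    exact: mhom0 psiM.
  apply: (mhom_mulI jM (x := x + y)).
  by rewrite /= sE piD (mhomD psiM) -!sE iMul (mhomD jM) mulrACA.
exists s; split; first split=> // g.
  exists #|G|; split; first by apply/card_gt0P; exists 0.
  by rewrite -(mhomMn sM) mulrn_card (mhom0 sM).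
move=> r; rewrite HE; split=> [[h ->]|[g ->]].
  by exists (p h); rewrite sE piK.
by exists (pi g); rewrite sE.
Qed.

End Main.

Theorem theorem1p6 (A : comPzRingType) (Gam : zmodType) (Ag : Gam -> A -> Prop)
    (G : finZmodType) (R : comPzRingType) (iota : A -> R) (j : G -> R) :
  is_order A -> reduced A -> connected A -> stark A ->
  universal_grading Ag ->
  group_ring_on (fun _ : R => True) iota j ->
  forall B H : R -> Prop,
    (in_D B H /\ stark_on B) <->
    ((exists t : Gam -> G, ahom t /\ forall r, B r <-> A_t Ag iota j t r) /\
     (exists s : G -> A, (mhom s /\ forall g, mu_elt (s g)) /\
                         forall r, H r <-> H_s iota j s r)).
Proof.
move=> oA rA cA stA uA AG B H; split=> [[inD stB]|].
  exact: (stark_basis_degrees oA rA cA stA uA AG inD stB).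
move=> [[t [tD BE]] [s [[sM _] HE]]].
exact: (stark_basis_twisted oA rA cA stA uA AG tD BE sM HE).
Qed.
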